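(* Let $n\ge 1$, let $A\in \mathrm{GL}(n,\mathbb{R})$ have columns $v_1,\ldots,v_n$, and consider the open cones $$\mathcal{C}=\Big\{\sum_{i=1}^n c_i v_i \;:\; c_i>0 \text{ for all } i\Big\},\qquad \mathcal{C}^*=\Big\{\sum_{i=1}^n c_i (A^{T})^{-1}e_i \;:\; c_i>0 \text{ for all } i\Big\},$$ where $e_1,\ldots,e_n$ is the standard basis of $\mathbb{R}^n$. Let $H=H(p,q):T^*\mathbb{T}^n\to\mathbb{R}$ be a $C^\infty$ autonomous Hamiltonian that is compactly supported in $\mathcal{C}\times\mathbb{T}^n$ and satisfies $H(p^*,q)>0$ for some $p^*\in\mathcal{C}$ and all $q\in\mathbb{T}^n$. Then for each nontrivial homology class $\alpha\in\mathcal{C}^*\cap H_1(\mathbb{T}^n,\mathbb{Z})$ there exists a dense subset $S_\alpha\subset\big(0,\min_{q\in\mathbb{T}^n}H(p^*,q)\big)$ such that for each $s\in S_\alpha$ the level set $\{H=s\}$ contains a closed orbit of the Hamiltonian flow of $H$ (not necessarily of period $1$) in the class $\alpha$.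
   Context: $\mathbb{T}^n=\mathbb{R}^n/\mathbb{Z}^n$. The cotangent bundle $T^*\mathbb{T}^n$ is identified with $\mathbb{R}^n\times\mathbb{T}^n$ with coordinates $(p,q)$, carrying the standard symplectic form. The Hamiltonian equations are $\dot q=\partial H/\partial p$, $\dot p=-\partial H/\partial q$. Homology classes $\alpha\in H_1(\mathbb{T}^n,\mathbb{Z})\cong\mathbb{Z}^n$ are regarded as vectors in $\mathbb{Z}^n\subset\mathbb{R}^n$. A closed orbit in the class $\alpha$ is a solution $x(t)=(p(t),q(t))$ with $x(t+T)=x(t)$ for some period $T>0$ such that the loop $t\mapsto q(t)$, $t\in[0,T]$, represents $\alpha$, i.e. any lift $\tilde q$ of $q$ to $\mathbb{R}^n$ satisfies $\tilde q(T)-\tilde q(0)=\alpha$. *)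

(* Defs.v *)
From HB Require Import structures.
From mathcomp Require Import all_boot all_order all_algebra.
From mathcomp Require Import generic_quotient archimedean.
From mathcomp Require Import all_classical all_reals all_analysis.

Set Implicit Arguments.
Unset Strict Implicit.
Unset Printing Implicit Defensive.

Import Order.TTheory GRing.Theory Num.Theory.
Import numFieldNormedType.Exports.

Local Open Scope classical_set_scope.
Local Open Scope ring_scope.
Local Open Scope quotient_scope.

Section Torus.
Variables (R : realType) (n : nat).

Definition lattice_equiv (u v : 'cV[R]_n) : bool := u - v \is a mxOver Num.int.

Lemma lattice_equiv_refl : reflexive lattice_equiv.
Proof.
move=> u; rewrite /lattice_equiv subrr.
by apply/mxOverP => i j; rewrite mxE rpred0.
Qed.

Lemma lattice_equiv_sym : symmetric lattice_equiv.
Proof.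
move=> u v; rewrite /lattice_equiv.
apply/mxOverP/mxOverP => uv i j; have := uv i j;
  by rewrite !mxE -rpredN opprB.
Qed.

Lemma lattice_equiv_trans : transitive lattice_equiv.
Proof.
move=> v u w /mxOverP uv /mxOverP vw; apply/mxOverP => i j.
have := rpredD (uv i j) (vw i j).
by rewrite !mxE addrA subrK.
Qed.

Canonical lattice_equiv_equiv :=
  EquivRel lattice_equiv lattice_equiv_refl lattice_equiv_sym
    lattice_equiv_trans.

Definition torus := quotient_topology {eq_quot lattice_equiv}.

HB.instance Definition _ := Topological.on torus.
HB.instance Definition _ := Quotient.on torus.

Definition torus_proj (v : 'cV[R]_n) : torus := \pi_torus v.

Lemma torus_projP (u v : 'cV[R]_n) :
  torus_proj u = torus_proj v <-> u - v \is a mxOver Num.int.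
Proof.
have uvP : reflect (torus_proj u = torus_proj v) (lattice_equiv u v).
  exact: (@eqquotP _ _ {eq_quot lattice_equiv} u v).
by split=> /uvP.
Qed.

Lemma torus_compact : compact [set: torus].
Proof.
pose K := [set v : 'rV[R]_n | forall i, `[0, 1]%classic (v ord0 i)].
have cK : compact K.
  exact (@rV_compact R n (fun=> `[0, 1]%classic)
    (fun=> @segment_compact _ _ _)).
have ctr : continuous (trmx : 'rV[R]_n -> 'cV[R]_n).
  move=> v B [P vP PB]; exists (fun i j => P j i).
    by move=> i j /=; have := vP j i; rewrite mxE.
  by move=> w Pw; apply: PB => i j; rewrite mxE; exact: Pw.
rewrite (_ : setT = (torus_proj \o trmx) @` K); last first.
  apply/seteqP; split=> // q _; rewrite /K /=.
  exists (\row_i (repr q i 0 - (Num.floor (repr q i 0))%:~R)).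
    move=> i /=; rewrite mxE in_itv /= subr_ge0 floor_le_tmp //=.
    by rewrite lerBlDr addrC -intrD1 ltW// floorD1_gt.
  rewrite -[RHS](@reprK _ torus); apply/torus_projP/mxOverP => i j.
  rewrite ord1 !mxE addrAC subrr add0r rpredN.
  exact: intr_int.
apply: continuous_compact => //.
apply/continuous_subspaceT => v.
by apply: continuous_comp; [exact: ctr | exact: pi_continuous].
Qed.

(* An infimum, attained for continuous f by torus_minP *)
Definition torus_min (f : torus -> R) : R := inf (range f).

Lemma torus_minP (f : torus -> R) : continuous f ->
  (exists q, f q = torus_min f) /\ (forall q, torus_min f <= f q).
Proof.
move=> cf.
have T0 : [set: torus] !=set0 by exists (torus_proj 0).
have cfT : {within [set: torus], continuous f} by exact: continuous_subspaceT.
have [q0 _ minq] := compact_EVT_min T0 torus_compact cfT.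
have minq0 q : f q0 <= f q by exact/minq/mem_set.
suff -> : torus_min f = f q0 by split; [exists q0 | move=> q; exact: minq0].
apply/le_anti/andP; split.
  by apply: ge_inf; [exists (f q0) => _ [q _ <-]; exact: minq0 | exists q0].
by apply: lb_le_inf; [exists (f q0), q0 | move=> _ [q _ <-]; exact: minq0].
Qed.

End Torus.

Section Smooth.
Variables (R : realType) (V W : normedModType R).

(* C^k through directional derivatives; on the finite-dimensional spaces used
   below these are the linear combinations of the partial derivatives. *)
Fixpoint class_C (k : nat) (f : V -> W) : Prop :=
  if k is k'.+1 then
    (forall x, differentiable f x) /\ (forall v, class_C k' (fun x => 'D_v f x))
  else continuous f.

Definition smooth (f : V -> W) : Prop := forall k, class_C k f.

End Smooth.

Section Hamiltonian.
Variables (R : realType) (n : nat).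

(* In coordinates (p, q): momentum first. *)
Definition cotangent : Type := ('cV[R]_n * torus R n)%type.

HB.instance Definition _ := Topological.on cotangent.

(* The pull-back of H to the universal cover R^n * R^n, where derivatives are
   taken *)
Definition lift_fun (H : cotangent -> R) (z : 'cV[R]_n * 'cV[R]_n) : R :=
  H (z.1, torus_proj z.2).

Definition smooth_cotangent (H : cotangent -> R) : Prop := smooth (lift_fun H).

Definition grad_p (F : 'cV[R]_n * 'cV[R]_n -> R) z : 'cV[R]_n :=
  \col_i 'D_(delta_mx i 0 : 'cV[R]_n, 0 : 'cV[R]_n) F z.

Definition grad_q (F : 'cV[R]_n * 'cV[R]_n -> R) z : 'cV[R]_n :=
  \col_i 'D_(0 : 'cV[R]_n, delta_mx i 0 : 'cV[R]_n) F z.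

Definition tsupport (H : cotangent -> R) : set cotangent :=
  closure [set z | H z != 0].

Definition is_lift (q : R -> torus R n) (qt : R -> 'cV[R]_n) : Prop :=
  continuous qt /\ forall t, torus_proj (qt t) = q t.

Definition hamiltonian_orbit (H : cotangent -> R) (x : R -> cotangent) : Prop :=
  exists2 qt : R -> 'cV[R]_n, is_lift (fun t => (x t).2) qt &
    forall t : R,
      is_derive t 1 qt (grad_p (lift_fun H) ((x t).1, qt t)) /\
      is_derive t 1 (fun t => (x t).1)
        (- grad_q (lift_fun H) ((x t).1, qt t)).

(* T is any period of x, not necessarily the least one. *)
Definition closed_orbit (H : cotangent -> R) (alpha : 'cV[R]_n)
    (x : R -> cotangent) : Prop :=
  hamiltonian_orbit H x /\
  exists T : R, [/\ 0 < T, forall t, x (t + T) = x t &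
    forall qt, is_lift (fun t => (x t).2) qt -> qt T - qt 0 = alpha].

Definition open_cone (v : 'I_n -> 'cV[R]_n) : set 'cV[R]_n :=
  [set u | exists c : 'I_n -> R,
    (forall i, 0 < c i) /\ u = \sum_(i < n) c i *: v i].

End Hamiltonian.

(* Main.v *)
Require Import Defs.
From mathcomp Require Import all_boot all_order all_algebra.
From mathcomp Require Import all_classical all_reals all_analysis.
From mathcomp Require Import archimedean ring lra zify.
Set Implicit Arguments.
Unset Strict Implicit.
Unset Printing Implicit Defensive.
Import Order.TTheory GRing.Theory Num.Theory.
Import numFieldNormedType.Exports.
Local Open Scope ring_scope.

(** The closed orbit is found as a critical point of the action functional, by a
linking argument carried out on finite-dimensional spaces of discrete loops.

Reduction. Around a given level choose [a < b] and compose [H] with a monotone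
[C^1] cutoff [f] that is 0 below [a] and a large constant above [b]. Put
[K = f o H]. The Hamiltonian field of [K] is [f'(H)] times the one of [H], so an
orbit of [K] of period 1 in the nonzero class [alpha] stays on one level [h] of
[H]; it is not constant, hence [f'(h) > 0], which forces [a < h < b], and after a
change of speed it is a closed orbit of [H] on the level [h] ([orbit_between]).
As the interval [(a, b)] is arbitrary, the levels obtained are dense.

Critical points. Discretise the circle by [N + 1] points and the Hamilton equations
by the symplectic Euler scheme; its solutions in the class [alpha] are the critical
points of [discrete_action]. Write [<p, alpha>] for the scalar product. The
condition on the cones gives [<p, alpha> > 0] wherever [H] does not vanish. On the
set of loops whose momentum is a constant [p] with [<p, alpha> = 0], the action is
therefore 0. On the other hand there is a box of loops, [test_loop], on whose
boundary the action is at most [-1]: one face lies in the half-space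
[<p, alpha> < 0], the opposite one near [p = pstar], where [K] is larger than
[<p, alpha>], and on the other ones a negative quadratic term dominates. The two
sets link ([linking]): a deformation of the box that fixes its boundary still
meets the first set, by the Poincare-Miranda theorem. If the gradient of the action
were bounded away from 0, finitely many gradient steps would push the box into the
region where the action is negative ([deformation]), a contradiction. So there are
loops with arbitrarily small gradient ([near_critical_loop]).

The Poincare-Miranda theorem is derived from a combinatorial statement modulo 2,
which is proved with cup products of coboundaries on a cubical grid
([box_sum_cup]).

Limit. Unrolled along the integers, a loop with tiny gradient is an approximate
Euler polygon of the Hamiltonian field. When [N] tends to infinity these polygons
converge pointwise along an ultrafilter, and the first-order estimate that they
satisfy passes to the limit and says that the limit is differentiable and solves
the Hamilton equations ([limit_curve], [periodic_orbit]). *)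

(** * A combinatorial degree modulo 2 on cubical grids *)

Section CubicalCochains.
Variable m : nat.
Notation point := ('I_m -> nat).
Notation cochain := (point -> 'F_2).

Definition bump_at (j : 'I_m) (v : point) : point := fun i => (v i + (i == j))%N.

Definition set_at (j : 'I_m) (a : nat) (v : point) : point :=
  fun i => if i == j then a else v i.

Definition fdiff (j : 'I_m) (g : cochain) : cochain := fun v => g (bump_at j v) - g v.

(** The cup product of the coboundaries of [ss], summed over the monotone lattice
paths from [v] that use each direction of [J] at most once. When [J] has as many
elements as [ss], these paths are the simplices of the Kuhn triangulation of the
unit cube at [v] in the directions [J]. *)
Fixpoint cup (ss : seq cochain) (J : {set 'I_m}) : cochain :=
  if ss is s :: ss' then
    fun v => \sum_(j in J) fdiff j s v * cup ss' (J :\ j) (bump_at j v)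
  else fun=> 1.

Lemma bump_atC i j v : bump_at i (bump_at j v) = bump_at j (bump_at i v).
Proof. by apply/funext => x; rewrite /bump_at addnAC. Qed.

Lemma addrr_F2 (x : 'F_2) : x + x = 0.
Proof. by apply: addrr_pchar2; exact: pchar_Fp. Qed.

(** The asymmetric Leibniz rule. Its first term has the shape of a summand of
[cup], which makes [cup (s :: ss)] a coboundary, up to a term killed by
[cup_closed]. *)
Lemma fdiff_mul j (g h : cochain) v :
  fdiff j (fun w => g w * h w) v = fdiff j g v * h (bump_at j v) + g v * fdiff j h v.
Proof. by rewrite /fdiff mulrBl mulrBr addrA subrK. Qed.

Lemma fdiff_sum (P : pred 'I_m) j (g : 'I_m -> cochain) v :
  fdiff j (fun w => \sum_(i | P i) g i w) v = \sum_(i | P i) fdiff j (g i) v.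
Proof. by rewrite /fdiff sumrB. Qed.

Lemma fdiffC i j g v : fdiff i (fdiff j g) v = fdiff j (fdiff i g) v.
Proof. by rewrite /fdiff bump_atC; ring. Qed.

(** The pairs [(i, j)] and [(j, i)] cancel modulo 2. This replaces the orientation
signs of simplices. *)
Lemma sum_symmetric0 (J : {set 'I_m}) (f : 'I_m -> 'I_m -> 'F_2) :
  (forall i j, f i j = f j i) ->
  \sum_(i in J) \sum_(j in J :\ i) f i j = 0.
Proof.
move=> fC.
have -> : \sum_(i in J) \sum_(j in J :\ i) f i j =
    \sum_(i in J) \sum_(j in J | (j < i)%N) f i j +
    \sum_(i in J) \sum_(j in J | (i < j)%N) f i j.
  rewrite -big_split; apply: eq_bigr => i _ /=.
  rewrite (bigID (fun j : 'I_m => (j < i)%N)) /=; congr (_ + _).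
    apply: eq_bigl => j; rewrite !inE -val_eqE /=.
    by case: (ssrnat.ltngtP (val j) (val i)); rewrite ?andbT ?andbF.
  apply: eq_bigl => j; rewrite !inE -val_eqE /=.
  by case: (ssrnat.ltngtP (val j) (val i)); rewrite ?andbT ?andbF.
rewrite [X in _ + X](exchange_big_dep (mem J)) /=; last by move=> i j _ /andP[].
rewrite [X in _ + X](_ : _ = \sum_(i in J) \sum_(j in J | (j < i)%N) f i j).
  exact: addrr_F2.
by apply: eq_bigr => i iJ; rewrite big_mkcondr [RHS]big_mkcondr /=;
  rewrite [RHS]big_mkcond [LHS]big_mkcond /=; apply: eq_bigr => j _; rewrite iJ fC.
Qed.

(** A product of coboundaries is a cocycle. By the Leibniz rule the sum splits into
second differences, symmetric in the two directions and hence zero modulo 2, and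
a part that vanishes by induction on [ss]. *)
Lemma cup_closed ss (J : {set 'I_m}) v :
  \sum_(j in J) fdiff j (cup ss (J :\ j)) v = 0.
Proof.
elim: ss J v => [|s ss IH] J v /=.
  by rewrite big1 // => j _; rewrite /fdiff subrr.
under eq_bigr => j _ do rewrite fdiff_sum.
have E i j : fdiff j (fun w => fdiff i s w * cup ss (J :\ j :\ i) (bump_at i w)) v =
    fdiff j (fdiff i s) v * cup ss (J :\ j :\ i) (bump_at i (bump_at j v)) +
    fdiff i s v * fdiff j (cup ss (J :\ j :\ i)) (bump_at i v).
  rewrite (fdiff_mul _ _ (fun w => cup ss (J :\ j :\ i) (bump_at i w))).
  by rewrite /fdiff /= (bump_atC j i).
under eq_bigr => j _ do (under eq_bigr => i _ do rewrite E).
have setD1C i j : J :\ i :\ j = J :\ j :\ i.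
  by apply/setP => x; rewrite !inE andbCA.
under eq_bigr => j _ do rewrite big_split /=.
rewrite big_split /= sum_symmetric0 ?add0r; last first.
  by move=> i j; rewrite fdiffC bump_atC setD1C.
rewrite (exchange_big_dep (mem J)) /=; last by move=> i j _; rewrite inE => /andP[].
rewrite big1 // => i iJ; rewrite (eq_bigl (mem (J :\ i))); last first.
  by move=> j; rewrite !inE iJ andbT andbC eq_sym.
under eq_bigr => j _ do rewrite setD1C.
by rewrite -mulr_sumr IH mulr0.
Qed.

(** Every summand of [cup] contains a difference of [s] between two consecutive
points of a path that stays in [P]. It is used with [P] a face of the box. *)
Lemma cup_const0 ss (K : {set 'I_m}) (P : point -> Prop) s v :
  (forall i w, i \in K -> P w -> P (bump_at i w)) ->
  (forall w w', P w -> P w' -> s w = s w') ->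
  P v -> List.In s ss -> cup ss K v = 0.
Proof.
move=> + sP; elim: ss K v => [//|s0 ss IH] K v KP Pv /= [->|sss]; apply: big1 => i iK.
  by rewrite /fdiff (sP _ _ _ Pv) ?subrr ?mul0r//; exact: KP.
rewrite (IH (K :\ i)) ?mulr0//.
  by move=> j w; rewrite inE => /andP[_]; exact: KP.
exact: KP.
Qed.

(** A nonzero summand is a path along which each cochain of [ss] changes its value
at some edge, and the path stays in one unit cube. *)
Lemma cup_neq0 ss (J : {set 'I_m}) v : cup ss J v != 0 ->
  forall s, List.In s ss -> exists u u' : point,
  [/\ forall i, (v i <= u i <= v i + (i \in J))%N,
      forall i, (v i <= u' i <= v i + (i \in J))%N & s u != s u'].
Proof.
elim: ss J v => [//|s0 ss IH] J v /= H.
have [j jJ Hj] : exists2 j, j \in J & fdiff j s0 v * cup ss (J :\ j) (bump_at j v) != 0.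
  apply: contrapT => nH; move/negP: H; apply; apply/eqP/big1 => j jJ.
  by apply/eqP/negPn/negP => Hj; apply: nH; exists j.
move: Hj; rewrite mulf_eq0 negb_or => /andP[d0 c0] s [<-|sss].
  exists (bump_at j v), v; split=> [i|i|]; rewrite /bump_at.
  - by rewrite leq_addr leq_add2l; have [->|] := eqVneq i j; rewrite ?jJ.
  - by rewrite leqnn leq_addr.
  - by rewrite -subr_eq0.
have le i : (bump_at j v i + (i \in J :\ j) <= v i + (i \in J))%N.
  rewrite /bump_at !inE -addnA leq_add2l.
  by have [->|] := eqVneq i j; rewrite ?jJ ?addn0.
have [u [u' [Hu Hu' ?]]] := IH _ _ c0 _ sss.
by exists u, u'; split=> // i; [have := Hu i|have := Hu' i] => /andP[a b];
  rewrite (leq_trans b (le i)) (leq_trans _ a) // /bump_at leq_addr.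
Qed.

Variable k : nat.

Fixpoint box_sum (J : seq 'I_m) (g : cochain) (v : point) : 'F_2 :=
  if J is j :: J' then \sum_(a < k) box_sum J' g (set_at j a v) else g v.

Lemma eq_box_sum J g h v :
  (forall w, (forall i, i \notin J -> w i = v i) -> g w = h w) ->
  box_sum J g v = box_sum J h v.
Proof.
elim: J v => [|j J IH] v gh /=; first by apply: gh.
apply: eq_bigr => a _; apply: IH => w wv; apply: gh => i.
by rewrite inE negb_or => /andP[/negPf ij iJ]; rewrite wv // /set_at ij.
Qed.

Lemma box_sum0 J v : box_sum J (fun=> 0) v = 0.
Proof. by elim: J v => [//|j J IH] v /=; apply: big1 => a _; rewrite IH. Qed.

Lemma box_sum_sum (P : pred 'I_m) J (g : 'I_m -> cochain) v :
  box_sum J (fun w => \sum_(i | P i) g i w) v = \sum_(i | P i) box_sum J (g i) v.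
Proof.
elim: J v => [//|j J IH] v /=; rewrite exchange_big /=.
by apply: eq_bigr => a _; rewrite IH.
Qed.

Lemma bump_set_at j a v : bump_at j (set_at j a v) = set_at j a.+1 v.
Proof.
by apply/funext => i; rewrite /bump_at /set_at; case: eqP => _; rewrite ?addn1 ?addn0.
Qed.

Lemma set_atC i j a b v : i != j -> set_at i a (set_at j b v) = set_at j b (set_at i a v).
Proof.
move=> ij; apply/funext => x; rewrite /set_at.
by have [->|//] := eqVneq x i; rewrite (negPf ij).
Qed.

Lemma box_sum_fdiff j J g v : j \notin J ->
  box_sum J (fdiff j g) v = box_sum J g (bump_at j v) - box_sum J g v.
Proof.
elim: J v => [//|i J IH] v; rewrite inE negb_or => /andP[ji jJ] /=.
rewrite -sumrB; apply: eq_bigr => a _; rewrite IH//; congr (box_sum _ _ _ - _).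
apply/funext => x; rewrite /bump_at /set_at.
by have [->|//] := eqVneq x i; rewrite eq_sym (negPf ji) addn0.
Qed.

(** Stokes' formula for a box, in one direction: only the two faces orthogonal to
[j] remain. *)
Lemma box_sum_telescope j J g v : uniq J -> j \in J ->
  box_sum J (fdiff j g) v =
  box_sum (rem j J) g (set_at j k v) - box_sum (rem j J) g (set_at j 0 v).
Proof.
elim: J v => [//|i J IH] v /= /andP[iJ uJ]; rewrite inE eq_sym.
have [ij _|ij /= jJ] := eqVneq i j.
  subst j; rewrite (eq_bigr (fun a : 'I_k =>
    box_sum J g (set_at i a.+1 v) - box_sum J g (set_at i a v))); last first.
    by move=> a _; rewrite box_sum_fdiff// bump_set_at.
  rewrite -(big_mkord xpredT (fun a =>
    box_sum J g (set_at i a.+1 v) - box_sum J g (set_at i a v))).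
  by rewrite telescope_sumr.
rewrite -sumrB; apply: eq_bigr => a _.
by rewrite IH// !(set_atC _ _ _ ij).
Qed.

Lemma box_sum_neq0 J g v : uniq J -> box_sum J g v != 0 ->
  exists w : point, [/\ forall i, i \in J -> (w i < k)%N,
    forall i, i \notin J -> w i = v i & g w != 0].
Proof.
elim: J v => [|j J IH] v /=; first by move=> _ ?; exists v.
move=> /andP[jJ uJ] H.
have [a Ha] : exists a : 'I_k, box_sum J g (set_at j a v) != 0.
  apply: contrapT => nH; move/negP: H; apply; apply/eqP; apply: big1 => a _.
  by apply/eqP/negPn/negP => Ha; apply: nH; exists a.
have [w [wk wv gw]] := IH _ uJ Ha; exists w; split=> // i.
  by rewrite inE => /predU1P[->|/wk//]; rewrite wv// /set_at eqxx.
by rewrite inE negb_or => /andP[ij iJ]; rewrite wv// /set_at (negPf ij).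
Qed.

Lemma In_map (s : 'I_m -> cochain) J j : j \in J -> List.In (s j) (map s J).
Proof.
elim: J => [//|i J IH]; rewrite inE => /predU1P[->|jJ]; first by left.
by right; exact: IH.
Qed.

(** The degree of a map that behaves on the boundary of the box like the identity
is 1. By [fdiff_mul] and [cup_closed] the integrand is a sum of differences, and
after telescoping only faces remain. On a face orthogonal to [j != i] the cochain
[s j] is constant, so the product vanishes; on the face [w i = 0] the factor [s i]
is 0; on the face [w i = k] it is 1 and the rest is the same sum in one dimension
less. *)
Lemma box_sum_cup (s : 'I_m -> cochain) J v : uniq J ->
  (forall i w, w i = 0%N -> s i w = 0) ->
  (forall i w, w i = k -> s i w = 1) ->
  box_sum J (cup (map s J) [set i in J]) v = 1.
Proof.
move=> + s0 s1; elim: J v => [//|i J IH] v /[!cons_uniq] /andP[iJ uJ].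
pose h j w := s i w * cup (map s J) ([set x in i :: J] :\ j) w.
rewrite (@eq_box_sum (i :: J) _ (fun w => \sum_(j in [set x in i :: J]) fdiff j (h j) w)); last first.
  move=> w _ /=; under [RHS]eq_bigr => j _ do rewrite fdiff_mul.
  by rewrite big_split /= -mulr_sumr cup_closed mulr0 addr0.
have iJ' : i \in [set x in i :: J] by rewrite !inE eqxx.
rewrite box_sum_sum (bigD1 i) //= [X in _ + X]big1 ?addr0; last first.
  move=> j; rewrite inE => /andP[jiJ ji].
  have jJ : j \in J by move: jiJ; rewrite inE (negPf ji).
  have face0 a : (a == 0 \/ a == k)%N ->
      box_sum (rem j (i :: J)) (h j) (set_at j a v) = 0.
    move=> ak; rewrite (@eq_box_sum _ _ (fun=> 0)) ?box_sum0// => w wv.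
    have wj : w j = a.
      by rewrite wv ?/set_at ?eqxx// mem_rem_uniq ?inE ?eqxx//= iJ.
    rewrite /h (@cup_const0 _ _ (fun w => w j = a) (s j)) ?mulr0//.
    - move=> l u; rewrite !inE => /andP[lj _] <-; rewrite /bump_at eq_sym (negPf lj).
      by rewrite addn0.
    - by move=> u u' uj u'j; case: ak => /eqP ak;
        [rewrite !s0|rewrite !s1]; rewrite ?uj ?u'j.
    - exact: In_map.
  rewrite -[LHS]/(box_sum (i :: J) (fdiff j (h j)) v) box_sum_telescope//; last by rewrite /= iJ.
  by rewrite !face0 ?subr0//; [left|right].
rewrite -[LHS]/(box_sum (i :: J) (fdiff i (h i)) v) box_sum_telescope ?inE ?eqxx//;
  last by rewrite /= iJ.
rewrite /= eqxx.
have -> : box_sum J (h i) (set_at i 0 v) = 0.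
  rewrite (@eq_box_sum _ _ (fun=> 0)) ?box_sum0// => w wv.
  by rewrite /h s0 ?mul0r// wv// /set_at eqxx.
rewrite subr0 -[RHS](IH (set_at i k v) uJ); apply: eq_box_sum => w wv.
rewrite /h s1 ?mul1r; last by rewrite wv// /set_at eqxx.
by congr (cup _ _ _); apply/setP => x; rewrite !inE; case: eqVneq => //= ->; rewrite (negPf iJ).
Qed.

(** A sum equal to 1 has a nonzero summand, and at that cell [cup_neq0] applies. *)
Lemma cell_with_all_sign_changes (s : 'I_m -> point -> bool) :
  (forall i w, w i = 0%N -> s i w = false) ->
  (forall i w, w i = k -> s i w = true) ->
  exists2 v : point, forall i, (v i < k)%N &
  forall i, exists u u' : point, [/\ forall j, (v j <= u j <= (v j).+1)%N,
    forall j, (v j <= u' j <= (v j).+1)%N & s i u && ~~ s i u'].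
Proof.
move=> s0 s1; pose sF i w : 'F_2 := (s i w)%:R.
have := @box_sum_cup sF (enum 'I_m) (fun=> 0%N) (enum_uniq _).
have -> // : [set i in enum 'I_m] = [set: 'I_m] by apply/setP => x; rewrite !inE mem_enum.
move=> E; have {}/E E : forall i w, w i = 0%N -> sF i w = 0 by move=> i w /s0; rewrite /sF => ->.
have {}/E E : forall i w, w i = k -> sF i w = 1 by move=> i w /s1; rewrite /sF => ->.
have : box_sum (enum 'I_m) (cup [seq sF i | i <- enum 'I_m] [set: 'I_m]) (fun=> 0%N) != 0.
  by rewrite E oner_eq0.
move=> /(box_sum_neq0 (enum_uniq _)) [v [vk _ /cup_neq0 H]].
exists v => [i|i]; first by apply: vk; rewrite mem_enum.
have [|u [u' [Hu Hu' suu']]] := H (sF i).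
  by apply: In_map; rewrite mem_enum.
have {}Hu j : (v j <= u j <= (v j).+1)%N by have := Hu j; rewrite inE addn1.
have {}Hu' j : (v j <= u' j <= (v j).+1)%N by have := Hu' j; rewrite inE addn1.
move: suu'; rewrite /sF; case su : (s i u); case su' : (s i u'); rewrite ?eqxx// => _.
  by exists u, u'; split=> //; rewrite su su'.
by exists u', u; split=> //; rewrite su su'.
Qed.
End CubicalCochains.

Local Open Scope classical_set_scope.

(** * The sup norm on matrices *)

Section MatrixNorm.
Variables (R : realType) (m n : nat).

Lemma le_mx_norm (x : 'M[R]_(m, n)) c : 0 <= c ->
  (`|x| <= c) <-> (forall i j, `|x i j| <= c).
Proof.
move=> c0; rewrite [`|x|]mx_normrE; split=> [xc i j|xc].
  exact: le_trans (le_bigmax _ (fun ij => `|x ij.1 ij.2|) (i, j)) xc.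
by apply/bigmax_leP; split=> // -[i j] _; exact: xc.
Qed.

Lemma mx_entry_le_norm (x : 'M[R]_(m, n)) i j : `|x i j| <= `|x|.
Proof. by apply: (le_mx_norm x (normr_ge0 _)).1. Qed.

Lemma continuous_mx (T : topologicalType) (f : T -> 'M[R]_(m, n)) :
  (forall i j, continuous (fun x => f x i j)) -> continuous f.
Proof.
move=> fc x B [P fP PB]; rewrite /= nbhs_simpl /=.
have : \forall y \near x, forall i j, P i j (f y i j).
  apply: filter_forall => i; apply: filter_forall => j.
  exact: fc (fP i j).
by apply: filterS => y Py; apply: PB.
Qed.

Lemma mx_ballP (x y : 'M[R]_(m, n)) e : 0 < e ->
  ball x e y <-> `|x - y| < e.
Proof. by move=> e0; rewrite mx_norm_ball. Qed.

End MatrixNorm.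

(** * The Poincare-Miranda theorem *)

Section PoincareMiranda.
Variables (R : realType) (m : nat) (lo hi : 'I_m -> R).
Hypothesis lohi : forall i, lo i < hi i.

Definition box : set 'rV[R]_m := [set x | forall i, `[lo i, hi i]%classic (x ord0 i)].

Definition grid_point (k : nat) (v : 'I_m -> nat) : 'rV[R]_m :=
  \row_i (lo i + (hi i - lo i) * ((minn (v i) k.+1)%:R / k.+1%:R)).

Lemma grid_point_box k v : box (grid_point k v).
Proof.
move=> i; rewrite /= in_itv /= mxE.
set t : R := _ / _.
have t0 : 0 <= t by rewrite divr_ge0.
have t1 : t <= 1 by rewrite ler_pdivrMr ?ltr0Sn// mul1r ler_nat geq_minr.
have lh : 0 <= hi i - lo i by rewrite subr_ge0 ltW.
by apply/andP; split; nra.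
Qed.

Lemma grid_point_cell k (v u : 'I_m -> nat) i :
  (v i <= u i <= (v i).+1)%N ->
  `|grid_point k v 0 i - grid_point k u 0 i| <= (hi i - lo i) / k.+1%:R.
Proof.
move=> /andP[vu uv]; rewrite !mxE.
have lh : 0 <= hi i - lo i by rewrite subr_ge0 ltW.
have /andP[a b] : (minn (v i) k.+1 <= minn (u i) k.+1 <= (minn (v i) k.+1).+1)%N by lia.
have k0 : 0 <= k.+1%:R^-1 :> R by rewrite invr_ge0.
rewrite [X in `|X|](_ : _ = (hi i - lo i) *
    (((minn (v i) k.+1)%:R - (minn (u i) k.+1)%:R) / k.+1%:R)); last by ring.
rewrite normrM ger0_norm// normrM [`|_^-1|]ger0_norm//.
apply: ler_wpM2l => //; rewrite ler_piMl// distrC -natrB// ger0_norm//.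
by rewrite lern1 leq_subLR addn1.
Qed.

Variable f : 'I_m -> 'rV[R]_m -> R.
Hypothesis fc : forall i, continuous (f i).
Hypothesis f_lo : forall i x, box x -> x 0 i = lo i -> f i x < 0.
Hypothesis f_hi : forall i x, box x -> x 0 i = hi i -> 0 <= f i x.

Lemma grid_sign_change k : exists v : 'I_m -> nat, forall i, exists u u' : 'I_m -> nat,
  [/\ forall j, (v j <= u j <= (v j).+1)%N, forall j, (v j <= u' j <= (v j).+1)%N,
      0 <= f i (grid_point k u) & f i (grid_point k u') < 0].
Proof.
have [| |v _ H] := @cell_with_all_sign_changes m k.+1 (fun i w => 0 <= f i (grid_point k w)).
- move=> i w wi; apply/negbTE; rewrite -ltNge; apply: f_lo; first exact: grid_point_box.
  by rewrite mxE wi min0n mul0r mulr0 addr0.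
- move=> i w wi; apply: f_hi; first exact: grid_point_box.
  by rewrite mxE wi minnn divff ?pnatr_eq0// mulr1 addrC subrK.
exists v => i; have [u [u' [Hu Hu' /andP[su su']]]] := H i.
by exists u, u'; split=> //; rewrite ltNge.
Qed.

(** On each grid some cell contains a sign change of every [f i]. Near a cluster
point of these cells no [f i] can keep a strict sign. *)
Theorem poincare_miranda : exists2 x, box x & forall i, f i x = 0.
Proof.
have [v Hv] := choice grid_sign_change.
pose x k := grid_point k (v k).
have cbox : compact box.
  exact: (@rV_compact R m (fun i => `[lo i, hi i]%classic) (fun=> @segment_compact _ _ _)).
have [|z [bz zcl]] := cbox (x @ \oo) _; first by exists 0%N => // k _; exact: grid_point_box.
exists z => // i; apply: contrapT => /eqP fz.
pose L := 1 + \sum_j (hi j - lo j).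
have L0 : 0 < L by rewrite ltr_pwDl// sumr_ge0// => j _; rewrite subr_ge0 ltW.
have [e e0 He] : exists2 e, 0 < e & forall y y', `|z - y| < e -> `|z - y'| < e ->
    0 <= f i y -> f i y' < 0 -> False.
  case: (ltgtP (f i z) 0) fz => // fz _.
    have /nbhs_ballP[e /= e0 He] : nbhs z (f i @^-1` `]-oo, 0[%classic).
      by apply: fc; apply: open_nbhs_nbhs; split; [exact: interval_open|rewrite /= in_itv].
    exists e => // y y' /(mx_ballP _ _ e0)/He /=; rewrite in_itv /= => fy _ fy0.
    by rewrite ltNge fy0 in fy.
  have /nbhs_ballP[e /= e0 He] : nbhs z (f i @^-1` `]0, +oo[%classic).
    by apply: fc; apply: open_nbhs_nbhs; split; [exact: interval_open|rewrite /= in_itv /= fz].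
  exists e => // y y' _ /(mx_ballP _ _ e0)/He /=; rewrite in_itv /= andbT => fy _ fy0.
  by move: (lt_trans fy fy0); rewrite ltxx.
have e20 : 0 < e / 2 by rewrite divr_gt0.
have eL : 0 < e / 2 / L by rewrite divr_gt0.
have [K _ HK] := near_infty_natSinv_lt (PosNum eL).
have [|y [[k kK <-] /= /(mx_ballP _ _ e20) zy]] :=
  zcl [set x k | k in [set k | (K <= k)%N]] _ _ (nbhsx_ballx z _ e20).
  by exists K => // k /= Kk; exists k.
have cell u : (forall j, (v k j <= u j <= (v k j).+1)%N) -> `|z - grid_point k u| < e.
  move=> Hu; have -> : z - grid_point k u = (z - x k) + (x k - grid_point k u).
    by rewrite addrA subrK.
  apply: le_lt_trans (ler_normD _ _) _; rewrite [ltRHS](splitr e) ltr_leD//.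
  apply/le_mx_norm; first exact: ltW.
  move=> a j; rewrite (ord1 a) !mxE -[X in X <= _]/(`|_ - _|).
  have := @grid_point_cell k (v k) u j (Hu j); rewrite !mxE => /le_trans; apply.
  have /= /ltW := HK k kK; rewrite ler_pdivlMr// mulrC; apply: le_trans.
  rewrite ler_pM2r ?invr_gt0//; apply: ler_wpDl => //.
  by rewrite (bigD1 j)//= lerDl sumr_ge0// => l _; rewrite subr_ge0 ltW.
have [u [u' [Hu Hu' fu fu']]] := Hv k i.
exact: He (cell u Hu) (cell u' Hu') fu fu'.
Qed.
End PoincareMiranda.

(** * Scalar product and deformation by gradient steps *)

Lemma sum_continuous (R : realType) (T : topologicalType) (I : Type) (r : seq I)
    (P : pred I) (f : I -> T -> R) : (forall i, continuous (f i)) ->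
  continuous (fun x => \sum_(i <- r | P i) f i x).
Proof.
by move=> fc; apply: continuous_big => [|i _]; [exact: add_continuous|exact: fc].
Qed.

Section Dot.
Variables (R : realType) (n : nat).
Implicit Types a b c : 'cV[R]_n.

Definition dot a b : R := \sum_i a i 0 * b i 0.

Lemma dotC a b : dot a b = dot b a.
Proof. by apply: eq_bigr => i _; rewrite mulrC. Qed.

Lemma dotDl a b c : dot (a + b) c = dot a c + dot b c.
Proof. by rewrite -big_split; apply: eq_bigr => i _; rewrite mxE mulrDl. Qed.

Lemma dotDr a b c : dot a (b + c) = dot a b + dot a c.
Proof. by rewrite dotC dotDl !(dotC a). Qed.

Lemma dotZl k a b : dot (k *: a) b = k * dot a b.
Proof. by rewrite mulr_sumr; apply: eq_bigr => i _; rewrite mxE mulrA. Qed.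

Lemma dotZr k a b : dot a (k *: b) = k * dot a b.
Proof. by rewrite dotC dotZl dotC. Qed.

Lemma dotNl a b : dot (- a) b = - dot a b.
Proof. by rewrite -scaleN1r dotZl mulN1r. Qed.

Lemma dotNr a b : dot a (- b) = - dot a b.
Proof. by rewrite dotC dotNl dotC. Qed.

Lemma dotBl a b c : dot (a - b) c = dot a c - dot b c.
Proof. by rewrite dotDl dotNl. Qed.

Lemma dotBr a b c : dot a (b - c) = dot a b - dot a c.
Proof. by rewrite dotDr dotNr. Qed.

Lemma dot0l a : dot 0 a = 0.
Proof. by rewrite -[0](subrr a) dotBl subrr. Qed.

Lemma dot_skew k a b : dot a (- (k *: b)) + dot b (k *: a) = 0.
Proof. by rewrite dotNr !dotZr (dotC b) addrC subrr. Qed.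

Lemma dot_suml (I : Type) (r : seq I) (P : pred I) (f : I -> 'cV[R]_n) b :
  dot (\sum_(i <- r | P i) f i) b = \sum_(i <- r | P i) dot (f i) b.
Proof. by apply: (big_morph (dot^~ b) (fun x y => dotDl x y b) (dot0l b)). Qed.

Lemma dot_sumr (I : Type) (r : seq I) (P : pred I) (f : I -> 'cV[R]_n) b :
  dot b (\sum_(i <- r | P i) f i) = \sum_(i <- r | P i) dot b (f i).
Proof. by rewrite dotC dot_suml; apply: eq_bigr => i _; exact: dotC. Qed.

Lemma dot_ge0 a : 0 <= dot a a.
Proof. by apply: sumr_ge0 => i _; rewrite -expr2 sqr_ge0. Qed.

Lemma dot_gt0 a : a != 0 -> 0 < dot a a.
Proof.
move=> a0; rewrite lt_neqAle dot_ge0 andbT eq_sym; apply: contra a0 => /eqP aa.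
apply/eqP/colP => i; rewrite mxE.
have nn j : true -> 0 <= a j 0 * a j 0 by rewrite -expr2 sqr_ge0.
have := psumr_eq0P nn aa => /(_ i isT)/eqP.
by rewrite mulf_eq0 orbb => /eqP.
Qed.

Lemma dot_le a b : `|dot a b| <= n%:R * (`|a| * `|b|).
Proof.
apply: le_trans (ler_norm_sum _ _ _) _.
have -> : n%:R * (`|a| * `|b|) = \sum_(i < n) `|a| * `|b|.
  by rewrite sumr_const card_ord mulr_natl.
by apply: ler_sum => i _; rewrite normrM ler_pM// mx_entry_le_norm.
Qed.

Lemma dot_continuous (T : topologicalType) (f g : T -> 'cV[R]_n) :
  continuous f -> continuous g -> continuous (fun x => dot (f x) (g x)).
Proof.
move=> fc gc x; apply: (@sum_continuous _ _ _ _ xpredT (fun i y => f y i 0 * g y i 0)) => i {}x.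
by apply: cvgM; apply: (continuous_comp (f := _) (g := fun M : 'cV[R]_n => M i 0));
  [exact: fc|exact: coord_continuous|exact: gc|exact: coord_continuous].
Qed.

End Dot.

Section Deformation.
Variables (R : realType) (X : normedModType R) (F : X -> R) (w : X -> X).
Variables (t0 kappa : R).
Hypotheses (Fc : continuous F) (wc : continuous w) (t0_gt0 : 0 < t0) (kappa_gt0 : 0 < kappa).
Hypothesis decr : forall x t, 0 <= t -> t <= t0 -> F (x - t *: w x) <= F x - t * kappa.

Let chi (s : R) : R := Num.min 1 (Num.max 0 (2 * s + 2)).
Let G (x : X) : X := x - (t0 * chi (F x)) *: w x.

Let chi_itv s : 0 <= chi s <= 1.
Proof. by rewrite /chi le_min ge_min !le_max !lexx ler01. Qed.

Let G_continuous : continuous G.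
Proof.
move=> x; apply: cvgB; first exact: cvg_id.
apply: cvgZ; last exact: wc.
apply: cvgM; first exact: cvg_cst.
apply: (@continuous_comp _ _ _ F chi); first exact: Fc.
apply: (@continuous_min R R (fun=> 1) (fun s => Num.max 0 (2 * s + 2))).
  exact: cvg_cst.
apply: (@continuous_max R R (fun=> 0) (fun s => 2 * s + 2)).
  exact: cvg_cst.
by apply: cvgD; [apply: cvgM; [exact: cvg_cst|exact: cvg_id]|exact: cvg_cst].
Qed.

Let G_id x : F x <= -1 -> G x = x.
Proof.
move=> Fx; rewrite /G /chi max_l; last by lra.
by rewrite min_r ?ler01// mulr0 scale0r subr0.
Qed.

Let G_le x : F (G x) <= Num.max (F x - t0 * kappa) (- 2^-1).
Proof.
have /andP[c0 c1] := chi_itv (F x).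
have : F (G x) <= F x - (t0 * chi (F x)) * kappa.
  by apply: decr; [exact: mulr_ge0 (ltW t0_gt0) c0|rewrite ler_piMr// ltW].
have [Fx|Fx] := leP (F x) (- 2^-1).
  rewrite le_max => FG; apply/orP; right; apply: le_trans FG _.
  have : 0 <= t0 * chi (F x) * kappa by rewrite mulr_ge0 ?(ltW kappa_gt0)// mulr_ge0// (ltW t0_gt0).
  by move: Fx; lra.
rewrite /chi max_r; last by lra.
rewrite min_l; last by lra.
by rewrite mulr1 le_max => ->.
Qed.

(** The deformation iterates the step [G], which moves [x] along [- w x] with a
length that is cut off to 0 where [F x <= -1]. Each step lowers [F] by a fixed amount
as long as [F] exceeds [-1/2] and never raises it, so the same number of steps is
enough for all points of the sublevel [B]. *)
Lemma deformation (B : R) : exists phi : X -> X,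
  [/\ continuous phi, forall x, F x <= -1 -> phi x = x &
      forall x, F x <= B -> F (phi x) < 0].
Proof.
have tk : 0 < t0 * kappa by rewrite mulr_gt0.
have [m Bm] : exists m : nat, B - m%:R * (t0 * kappa) < 0.
  exists (Num.Def.archi_bound (`|B| / (t0 * kappa))).
  have /archi_boundP : 0 <= `|B| / (t0 * kappa) by rewrite divr_ge0// ltW.
  rewrite ltr_pdivrMr// subr_lt0; apply: le_lt_trans; exact: ler_norm.
exists (iter m G); split=> [|x Fx|x Fx].
- elim: (m) => [|k IH]; first by move=> x; exact: cvg_id.
  by move=> x; apply: (@continuous_comp _ _ _ (iter k G) G); [exact: IH|exact: G_continuous].
- by elim: (m) => [//|k /= ->]; rewrite G_id.
- suff : F (iter m G x) <= Num.max (B - m%:R * (t0 * kappa)) (- 2^-1).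
    by move=> /le_lt_trans; apply; rewrite gt_max Bm; lra.
  elim: (m) => [|k IH] /=; first by rewrite mul0r subr0 le_max Fx.
  apply: le_trans (G_le _) _; rewrite ge_max !le_max lexx orbT andbT.
  have [a|a] := leP (B - k%:R * (t0 * kappa)) (- 2^-1).
    apply/orP; right; move: IH; rewrite max_r// => IH.
    by rewrite lerBlDr (le_trans IH)// lerDl ltW.
  apply/orP; left; move: IH; rewrite max_l ?(ltW a)// => IH.
  by rewrite -natr1; lra.
Qed.

End Deformation.

(** * The discrete action of a loop *)

Lemma pair_norm_le (R : realType) (V W : normedModType R) (z : V * W) c :
  (`|z| <= c) = (`|z.1| <= c) && (`|z.2| <= c).
Proof. by rewrite prod_normE ge_max. Qed.

Lemma pair_norm_ge (R : realType) (V W : normedModType R) (z : V * W) :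
  `|z.1| <= `|z| /\ `|z.2| <= `|z|.
Proof. by apply/andP; rewrite -pair_norm_le. Qed.

Lemma pair_continuous (T U V : topologicalType) (f : T -> U) (g : T -> V) :
  continuous f -> continuous g -> continuous (fun x => (f x, g x)).
Proof. by move=> fc gc x; exact: (cvg_pair (fc x) (gc x)). Qed.

Section DiscreteAction.
Variables (R : realType) (n N : nat) (alpha : 'cV[R]_n).
Notation phase := ('cV[R]_n * 'cV[R]_n)%type.
Notation loop := ('M[R]_(n, N.+1) * 'M[R]_(n, N.+1))%type.
Variables (K : phase -> R) (gp gq : phase -> 'cV[R]_n).

Let eps : R := N.+1%:R^-1.

(** A point of [loop] lists the momenta and the positions at the vertices of a
closed polygon. The lift of the position after one turn is the initial position
plus [alpha]; for [K] periodic in the position, this displacement shows only in the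
first summand. *)
Definition discrete_action (x : loop) : R :=
  dot (col ord_max x.1) alpha
  + \sum_k dot (col k x.1) (col (ordS k) x.2 - col k x.2)
  - eps * \sum_k K (col k x.1, col (ordS k) x.2).

Definition grad1 (x : loop) (k : 'I_N.+1) : 'cV[R]_n :=
  col (ordS k) x.2 - col k x.2 + (k == ord_max)%:R *: alpha
  - eps *: gp (col k x.1, col (ordS k) x.2).

Definition grad2 (x : loop) (k : 'I_N.+1) : 'cV[R]_n :=
  col (ord_pred k) x.1 - col k x.1 - eps *: gq (col (ord_pred k) x.1, col k x.2).

Definition grad (x : loop) : loop :=
  (\matrix_(i, k) grad1 x k i 0, \matrix_(i, k) grad2 x k i 0).

Definition loop_dot (x y : loop) : R :=
  \sum_k dot (col k x.1) (col k y.1) + \sum_k dot (col k x.2) (col k y.2).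

Lemma sum_ordS (V : nmodType) (f : 'I_N.+1 -> V) : \sum_k f (ordS k) = \sum_k f k.
Proof. by rewrite [RHS](reindex (@ordS N.+1))//; apply: onW_bij; exact: ordS_bij. Qed.

Lemma sum_by_parts (p y : 'M[R]_(n, N.+1)) :
  \sum_k dot (col k p) (col (ordS k) y - col k y) =
  \sum_k dot (col (ord_pred k) p - col k p) (col k y).
Proof.
under eq_bigr do rewrite dotBr; under [RHS]eq_bigr do rewrite dotBl.
rewrite !sumrB; congr (_ - _).
by rewrite -[RHS]sum_ordS; apply: eq_bigr => k _; rewrite ordSK.
Qed.

Lemma col_of_entries (p : 'I_N.+1 -> 'cV[R]_n) k : col k (\matrix_(i, j) p j i 0) = p k.
Proof. by apply/colP => i; rewrite !mxE. Qed.

(** The error of the first-order expansion of [K], with [(gp, gq)] in the role of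
the gradient. *)
Definition remainder (z h : phase) : R :=
  K (z + h) - K z - (dot (gp z) h.1 + dot (gq z) h.2).

(** The bilinear part of the action is expanded exactly, and a summation by parts
moves the differences of the increment [h.2] onto the momenta. *)
Lemma action_expansion x h : discrete_action (x + h) =
  discrete_action x + loop_dot (grad x) h
  + \sum_k dot (col k h.1) (col (ordS k) h.2 - col k h.2)
  - eps * \sum_k remainder (col k x.1, col (ordS k) x.2) (col k h.1, col (ordS k) h.2).
Proof.
have E a : dot (col ord_max a) alpha = \sum_k (k == ord_max)%:R * dot (col k a) alpha.
  rewrite (bigD1 ord_max)//= eqxx mul1r big1 ?addr0// => k /negPf ->.
  by rewrite mul0r.
rewrite /discrete_action /loop_dot !E /= -[X in _ + (_ + X) + _ - _]sum_ordS.
rewrite !mulr_sumr -!sumrN -!big_split /=.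
have D : \sum_k (dot (col k x.1) (col (ordS k) h.2 - col k h.2) -
  dot (col k x.1 - col (ordS k) x.1) (col (ordS k) h.2)) = 0.
  rewrite sumrB sum_by_parts -sum_ordS.
  by rewrite -sumrB big1// => k _; rewrite ordSK subrr.
rewrite -[RHS]addr0 -[X in _ = _ + X]D -big_split /=; apply: eq_bigr => k _.
rewrite !col_of_entries /grad1 /grad2 ordSK /remainder !linearD /=.
rewrite !(dotDl, dotDr, dotNl, dotNr, dotZl, dotZr) (dotC alpha).
rewrite -[(_, _) + (_, _)]/(col k x.1 + col k h.1, col (ordS k) x.2 + col (ordS k) h.2).
rewrite !(dotC (col k h.1)); ring.
Qed.

Lemma col_norm_le (a : 'M[R]_(n, N.+1)) k : `|col k a| <= `|a|.
Proof. by apply/le_mx_norm => // i j; rewrite mxE mx_entry_le_norm. Qed.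

Lemma loop_norm_sqr_le x : `|x| ^+ 2 <= loop_dot x x.
Proof.
have col_sqr (a : 'M[R]_(n, N.+1)) k i : a i k ^+ 2 <= \sum_j dot (col j a) (col j a).
  rewrite (bigD1 k)//= {1}/dot (bigD1 i)//= !mxE -expr2 -addrA lerDl.
  by apply: addr_ge0; apply: sumr_ge0 => j _; [rewrite -expr2 sqr_ge0|exact: dot_ge0].
have nn (a : 'M[R]_(n, N.+1)) : 0 <= \sum_k dot (col k a) (col k a).
  by apply: sumr_ge0 => k _; exact: dot_ge0.
have x0 : 0 <= loop_dot x x by rewrite addr_ge0.
suff : `|x| <= Num.sqrt (loop_dot x x).
  by rewrite -ler_sqr ?nnegrE ?sqrtr_ge0// sqr_sqrtr.
rewrite pair_norm_le; apply/andP; split; apply/le_mx_norm; rewrite ?sqrtr_ge0// => i k;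
  rewrite -sqrtr_sqr ler_sqrt//.
  by rewrite (le_trans (col_sqr _ k i))// lerDl.
by rewrite (le_trans (col_sqr _ k i))// lerDr.
Qed.

Lemma action_upper x h e :
  (forall z h' : phase, `|h'| <= `|h| -> `|remainder z h'| <= e * `|h'|) -> 0 <= e ->
  discrete_action (x + h) <= discrete_action x + loop_dot (grad x) h
     + (2 * n%:R * N.+1%:R) * `|h| ^+ 2 + e * `|h|.
Proof.
move=> He e0; have := normr_ge0 h; have [h1 h2] : `|h.1| <= `|h| /\ `|h.2| <= `|h|.
  by apply/andP; rewrite -pair_norm_le.
move: (`|h|) h1 h2 He => H h1 h2 He H0.
rewrite action_expansion -addrA -[leRHS]addrA lerD2l.
have cst (c : R) : N.+1%:R * c = \sum_(k < N.+1) c.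
  by rewrite sumr_const card_ord mulr_natl.
have N0 : N.+1%:R != 0 :> R by rewrite pnatr_eq0.
apply: lerD.
  rewrite (_ : _ * _ = \sum_(k < N.+1) 2 * n%:R * H ^+ 2); last by rewrite -cst; ring.
  apply: ler_sum => k _; apply: le_trans (ler_norm _) _; apply: le_trans (dot_le _ _) _.
  rewrite [leRHS](_ : _ = n%:R * (H * (2 * H))); last by ring.
  apply: ler_wpM2l => //; apply: ler_pM => //.
    exact: le_trans (col_norm_le _ _) h1.
  apply: le_trans (ler_normB _ _) _; rewrite [2 * H]mulrDl mul1r.
  by apply: lerD; apply: le_trans (col_norm_le _ _) h2.
rewrite -mulrN -sumrN (_ : e * H = eps * \sum_(k < N.+1) e * H); last first.
  by rewrite -cst mulrA mulVf// mul1r.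
rewrite ler_wpM2l ?invr_ge0//; apply: ler_sum => k _.
have le : `|(col k h.1, col (ordS k) h.2)| <= H.
  rewrite pair_norm_le /=; apply/andP.
  by split; [exact: le_trans (col_norm_le _ _) h1|exact: le_trans (col_norm_le _ _) h2].
apply: le_trans (ler_norm _) _; rewrite normrN; apply: le_trans (He _ _ le) _.
exact: ler_wpM2l.
Qed.

Hypothesis unif_diff : forall e : R, 0 < e -> exists2 d : R, 0 < d &
  forall z h : phase, `|h| <= d -> `|remainder z h| <= e * `|h|.
Hypotheses (Kc : continuous K) (gpc : continuous gp) (gqc : continuous gq).

(** Along the normalised gradient the linear term of [action_expansion] is at most
[- t * delta]; for small [t] the quadratic term and the remainder of [K], controlled
uniformly by [unif_diff], use up at most half of it. *)
Lemma action_descent (delta : R) : 0 < delta -> (forall x, delta <= `|grad x|) ->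
  exists2 t0 : R, 0 < t0 & forall x t, 0 <= t -> t <= t0 ->
    discrete_action (x - t *: (`|grad x|^-1 *: grad x)) <=
    discrete_action x - t * (delta / 2).
Proof.
move=> d0 dg; have d40 : 0 < delta / 4 by rewrite divr_gt0.
have [d dgt0 Hd] := unif_diff d40.
set C : R := 2 * n%:R * N.+1%:R.
have C0 : 0 <= C by rewrite !mulr_ge0.
(* up to d the remainder costs at most t * delta / 4, and up to delta / 4 / (C + 1)
   so does the quadratic term C * t ^+ 2 *)
exists (Num.min d (delta / 4 / (C + 1))).
  by rewrite lt_min dgt0 divr_gt0// ltr_wpDl.
move=> x t t0; rewrite le_min => /andP[td tC].
have g0 : 0 < `|grad x| by exact: lt_le_trans (dg x).
set h := - (t *: _).
have hn : `|h| = t.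
  by rewrite normrN !normrZ ger0_norm// normfV normr_id mulVf ?mulr1// gt_eqF.
have := @action_upper x h (delta / 4) _ (ltW d40); rewrite hn.
move=> /(_ (fun z h' hh => Hd z h' (le_trans hh td))) /le_trans; apply.
have gh : loop_dot (grad x) h <= - (t * delta).
  have -> : loop_dot (grad x) h = - (t * (`|grad x|^-1 * loop_dot (grad x) (grad x))).
    rewrite /loop_dot !mulrDr opprD !mulr_sumr -!sumrN; congr (_ + _); apply: eq_bigr => k _.
      have -> : col k h.1 = - (t *: (`|grad x|^-1 *: col k (grad x).1)).
        by apply/colP => i; rewrite !mxE.
      by rewrite dotNr !dotZr.
    have -> : col k h.2 = - (t *: (`|grad x|^-1 *: col k (grad x).2)).
      by apply/colP => i; rewrite !mxE.
    by rewrite dotNr !dotZr.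
  rewrite lerN2 ler_wpM2l// (le_trans (dg x))// mulrC ler_pdivlMr//.
  by rewrite -expr2 loop_norm_sqr_le.
move: tC; rewrite ler_pdivlMr; last by rewrite ltr_wpDl.
move=> tC; have : t * (t * (C + 1)) <= t * (delta / 4) by rewrite ler_wpM2l.
have : 0 <= t * t by rewrite mulr_ge0.
rewrite -/C expr2; move: gh; lra.
Qed.

Lemma col_continuous k : continuous (col k : 'M[R]_(n, N.+1) -> 'cV[R]_n).
Proof.
by apply: continuous_mx => i j; under eq_fun do rewrite mxE; exact: coord_continuous.
Qed.

Lemma fst_col_continuous k : continuous (fun x : loop => col k x.1).
Proof.
by move=> x; apply: (@continuous_comp _ _ _ (fun x : loop => x.1) (col k));
  [exact: cvg_fst|exact: col_continuous].
Qed.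

Lemma snd_col_continuous k : continuous (fun x : loop => col k x.2).
Proof.
by move=> x; apply: (@continuous_comp _ _ _ (fun x : loop => x.2) (col k));
  [exact: cvg_snd|exact: col_continuous].
Qed.

Lemma comp_pair_continuous (T : topologicalType) (f : phase -> T) j k : continuous f ->
  continuous (fun x : loop => f (col j x.1, col k x.2)).
Proof.
move=> fc x; apply: (@continuous_comp _ _ _ (fun x : loop => (col j x.1, col k x.2)) f).
  exact: (pair_continuous (@fst_col_continuous j) (@snd_col_continuous k)).
exact: fc.
Qed.

Lemma action_continuous : continuous discrete_action.
Proof.
move=> x; apply: cvgB; first apply: cvgD.
- exact: (dot_continuous (@fst_col_continuous _) (fun=> cvg_cst _)).
- apply: sum_continuous => k.
  apply: dot_continuous; first exact: fst_col_continuous.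
  by move=> {}x; apply: cvgB; exact: snd_col_continuous.
- apply: cvgM; first exact: cvg_cst.
  by apply: sum_continuous => k; exact: comp_pair_continuous.
Qed.

Lemma grad_continuous : continuous grad.
Proof.
have entry (T : topologicalType) (f : T -> 'cV[R]_n) i : continuous f ->
    continuous (fun x => f x i 0).
  move=> fc x; apply: (@continuous_comp _ _ _ f (fun v : 'cV[R]_n => v i 0)).
    exact: fc.
  exact: coord_continuous.
apply: pair_continuous.
  apply: (@continuous_mx _ _ _ _ (fun x => \matrix_(i, k) grad1 x k i 0)) => i k.
  under eq_fun do rewrite mxE; apply: entry => {}x.
  apply: cvgB; first apply: cvgD; first apply: cvgB.
  - exact: snd_col_continuous.
  - exact: snd_col_continuous.
  - exact: cvg_cst.
  - by apply: cvgZ; [exact: cvg_cst|exact: comp_pair_continuous].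
apply: (@continuous_mx _ _ _ _ (fun x => \matrix_(i, k) grad2 x k i 0)) => i k.
under eq_fun do rewrite mxE; apply: entry => {}x.
apply: cvgB; first apply: cvgB.
- exact: fst_col_continuous.
- exact: fst_col_continuous.
- by apply: cvgZ; [exact: cvg_cst|exact: comp_pair_continuous].
Qed.

End DiscreteAction.

(** * Linking and loops with small gradient *)

Section RealContinuous.
Variables (R : realType) (T : topologicalType).
Implicit Types f g : T -> R.

Lemma continuous_add f g : continuous f -> continuous g -> continuous (fun x => f x + g x).
Proof. by move=> fc gc x; apply: cvgD; [exact: fc|exact: gc]. Qed.

Lemma continuous_sub f g : continuous f -> continuous g -> continuous (fun x => f x - g x).
Proof. by move=> fc gc x; apply: cvgB; [exact: fc|exact: gc]. Qed.

Lemma continuous_mul f g : continuous f -> continuous g -> continuous (fun x => f x * g x).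
Proof. by move=> fc gc x; apply: cvgM; [exact: fc|exact: gc]. Qed.

End RealContinuous.

Section Linking.
Variables (R : realType) (n N : nat) (alpha : 'cV[R]_n).
Notation phase := ('cV[R]_n * 'cV[R]_n)%type.
Notation loop := ('M[R]_(n, N.+1) * 'M[R]_(n, N.+1))%type.
Variables (K : phase -> R) (gp gq : phase -> 'cV[R]_n) (pstar : 'cV[R]_n) (rho : R).
Let s := dot pstar alpha.
Hypotheses (s_gt0 : 0 < s) (rho_gt0 : 0 < rho) (K_ge0 : forall z, 0 <= K z).
Hypothesis K_barrier : forall p q, dot p alpha = 0 -> K (p, q) = 0.
Hypothesis K_high : forall p q, `|p - pstar| <= rho -> s + 2 <= K (p, q).

Let J : finType := option ('I_N * 'I_n)%type.
Notation param := 'rV[R]_#|J|.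
Let X (x : param) (j : J) : R := x 0 (enum_rank j).

(* the first bound on r keeps the linear part of the action below 1, the second one
   keeps the momenta within rho of pstar when the first of them is pstar *)
Let r : R := Num.min (1 + N%:R * \sum_i `|alpha i 0|)^-1 (rho / N.+1%:R).
Let lam : R := (s + 2) / r ^+ 2.

Let r_gt0 : 0 < r.
Proof.
rewrite lt_min divr_gt0// andbT invr_gt0 ltr_pwDl// mulr_ge0//.
exact: sumr_ge0.
Qed.

Let r_alpha : N%:R * r * \sum_i `|alpha i 0| <= 1.
Proof.
have S0 : 0 <= N%:R * \sum_i `|alpha i 0| :> R by rewrite mulr_ge0 ?sumr_ge0.
have : r <= (1 + N%:R * \sum_i `|alpha i 0|)^-1 by rewrite ge_min lexx.
rewrite -[_^-1]div1r ler_pdivlMr; last by rewrite ltr_pwDl.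
by move: r_gt0; lra.
Qed.

Let r_rho : N%:R * r <= rho.
Proof.
have : r <= rho / N.+1%:R by rewrite ge_min lexx orbT.
rewrite ler_pdivlMr ?ltr0Sn// -natr1; move: r_gt0; lra.
Qed.

Let lam_ge0 : 0 <= lam.
Proof. by rewrite divr_ge0 ?sqr_ge0// addr_ge0// ltW. Qed.

Let aa_gt0 : 0 < dot alpha alpha.
Proof.
apply: dot_gt0; apply: contraTneq s_gt0 => a0.
by rewrite /s a0 dotC dot0l ltxx.
Qed.

(** The coordinate [None] is the value of [dot p alpha] at the first momentum [p], which
moves on the line through [pstar] directed by [alpha]; the other coordinates are the
successive increments of the momenta. The positions are proportional to these
increments, which makes the bilinear part of the action negative
([action_test]). *)
Definition test_loop (x : param) : loop :=
  (\matrix_(i, k) (pstar i 0 + (X x None - s) / dot alpha alpha * alpha i 0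
     + \sum_(j < N | (j < k)%N) X x (Some (j, i))),
   \matrix_(i, k) if unlift ord0 k is Some j then lam * X x (Some (j, i)) else 0).

(** The simultaneous zeros of the probes are the loops of constant momentum
orthogonal to [alpha], and [probe_test] says that on test loops the probes read off
the coordinates. *)
Definition probe (z : loop) (j : J) : R :=
  if j is Some (k, i) then z.1 i (lift ord0 k) - z.1 i (widen_ord (leqnSn N) k)
  else dot (col ord0 z.1) alpha.

Lemma probe_test x j : probe (test_loop x) j = X x j.
Proof.
rewrite /probe; case: j => [[k i]|].
  rewrite !mxE [X in _ + _ + X - _](bigD1 k)//=.
  rewrite (eq_bigl (fun j : 'I_N => (j < k)%N)).
    by rewrite addrA [_ + X x _]addrC -addrA addrA addrAC -addrA; ring.
  by move=> j; rewrite -val_eqE /= /bump; lia.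
have -> : col ord0 (test_loop x).1 = pstar + ((X x None - s) / dot alpha alpha) *: alpha.
  by apply/colP => i; rewrite !mxE big_pred0 ?addr0.
by rewrite dotDl dotZl divfK ?gt_eqF// addrC subrK.
Qed.

(** After summation by parts the bilinear term pairs each position with the
corresponding increment of the momentum; [test_loop] makes it a multiple of the
square of that increment. *)
Lemma action_test x : discrete_action alpha K (test_loop x) =
  X x None + \sum_(k < N) \sum_(i < n) X x (Some (k, i)) * alpha i 0
  - lam * (\sum_(k < N) \sum_(i < n) X x (Some (k, i)) ^+ 2)
  - N.+1%:R^-1 * \sum_k K (col k (test_loop x).1, col (ordS k) (test_loop x).2).
Proof.
rewrite /discrete_action; congr (_ + _ - _).
  have -> : col ord_max (test_loop x).1 = pstar + ((X x None - s) / dot alpha alpha) *: alpha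
      + \col_i \sum_(k < N) X x (Some (k, i)).
    apply/colP => i; rewrite !mxE; congr (_ + _).
    by apply: eq_bigl => j; rewrite ltn_ord.
  rewrite !dotDl dotZl divfK ?gt_eqF// -/s addrCA subrr addr0; congr (_ + _).
  rewrite /dot exchange_big /=; apply: eq_bigr => i _.
  by rewrite mxE mulr_suml.
rewrite sum_by_parts big_ord_recl.
have -> : col ord0 (test_loop x).2 = 0.
  by apply/colP => i; rewrite !mxE unlift_none.
rewrite dotC dot0l add0r mulr_sumr -[RHS]sumrN; apply: eq_bigr => k _.
rewrite mulr_sumr -[RHS]sumrN; apply: eq_bigr => i _.
have -> : ord_pred (lift ord0 k) = widen_ord (leqnSn N) k.
  rewrite -[LHS](@ordSK N.+1) ordSK; apply: (can_inj (@ordSK N.+1)); rewrite ord_predK.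
  by apply/val_inj => /=; rewrite /bump /= modn_small// ltnS.
have := probe_test x (Some (k, i)); rewrite /probe => <-.
rewrite [X in _ * X](_ : _ = lam * X x (Some (k, i))); last by rewrite !mxE liftK.
rewrite -(probe_test x (Some (k, i))) /probe.
rewrite [X in X * _](_ : _ = (test_loop x).1 i (widen_ord (leqnSn N) k)
  - (test_loop x).1 i (lift ord0 k)).
  by ring.
by rewrite !mxE.
Qed.

Let lo (j : J) : R := if j is Some _ then - r else -2.
Let hi (j : J) : R := if j is Some _ then r else s.

Let in_box (x : param) := forall j, lo j <= X x j <= hi j.

Let linear_part_le x : in_box x ->
  \sum_(k < N) \sum_(i < n) X x (Some (k, i)) * alpha i 0 <= 1.
Proof.
move=> bx; apply: le_trans r_alpha.
rewrite (_ : _ * _ = \sum_(k < N) \sum_(i < n) r * `|alpha i 0|); last first.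
  by rewrite sumr_const card_ord -mulr_sumr -mulrA mulr_natl.
apply: ler_sum => k _; apply: ler_sum => i _.
apply: le_trans (ler_norm _) _; rewrite normrM ler_wpM2r// ler_norml.
exact: bx (Some (k, i)).
Qed.

Let eps_sum_ge (c : R) (f : 'I_N.+1 -> R) : (forall k, c <= f k) ->
  c <= N.+1%:R^-1 * \sum_k f k.
Proof.
move=> cf; rewrite mulrC ler_pdivlMr// mulr_natr -[in leLHS](card_ord N.+1) -sumr_const.
exact: ler_sum.
Qed.

Let sqr_part_ge0 x : 0 <= lam * \sum_(k < N) \sum_(i < n) X x (Some (k, i)) ^+ 2.
Proof.
by rewrite mulr_ge0// sumr_ge0// => k _; rewrite sumr_ge0// => i _; exact: sqr_ge0.
Qed.

Let action_test_le x : in_box x -> discrete_action alpha K (test_loop x) <= s + 1.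
Proof.
move=> bx; rewrite action_test; have := linear_part_le bx; have := sqr_part_ge0 x.
have /andP[_ /=] := bx None.
set a := \sum_(k < N) _; set b := lam * _; set c := _ * _.
have : 0 <= c by apply: eps_sum_ge => k; exact: K_ge0.
lra.
Qed.

(** On the faces of the momentum increments the quadratic term, of size
[lam * r ^+ 2 = s + 2], wins. On the face [X x None = -2] the linear term is already
small enough. On the face [X x None = s] all momenta are within [rho] of [pstar], so
that [K] takes off at least [s + 2]. *)
Let action_test_boundary x j : in_box x -> X x j = lo j \/ X x j = hi j ->
  discrete_action alpha K (test_loop x) <= -1.
Proof.
move=> bx xj; rewrite action_test; have := linear_part_le bx; have := sqr_part_ge0 x.
have /andP[_ /=] := bx None.
set a := \sum_(k < N) _; set b := lam * _; set c := _ * _.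
have : 0 <= c by apply: eps_sum_ge => k; exact: K_ge0.
case: j xj => [[k i]|/=].
  move=> xj; have xr : X x (Some (k, i)) ^+ 2 = r ^+ 2 by case: xj => -> /=; rewrite ?sqrrN.
  have : s + 2 <= b.
    have -> : s + 2 = lam * r ^+ 2 by rewrite divfK// gt_eqF// exprn_gt0.
    rewrite /b /a; apply: ler_wpM2l => //; rewrite -xr (bigD1 k)//= (bigD1 i)//= -addrA lerDl.
    apply: addr_ge0; first by apply: sumr_ge0 => l _; exact: sqr_ge0.
    by apply: sumr_ge0 => l _; apply: sumr_ge0 => l' _; exact: sqr_ge0.
  by lra.
case=> xj; first by rewrite xj; lra.
have : s + 2 <= c.
  apply: eps_sum_ge => k; apply: K_high; apply: le_trans r_rho.
  apply/le_mx_norm => [|i l]; first by rewrite mulr_ge0// ltW.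
  rewrite (ord1 l) !mxE xj subrr mul0r mul0r addr0 addrC addKr.
  apply: le_trans (ler_norm_sum _ _ _) _.
  rewrite mulr_natl -[in leRHS](card_ord N) -sumr_const.
  rewrite big_mkcond; apply: ler_sum => l' _.
  by case: ifP => _; [rewrite ler_norml; exact: bx (Some (l', i))|rewrite ltW].
rewrite xj; lra.
Qed.

Let test_loop_continuous : continuous test_loop.
Proof.
have cst_cont (c : R) : continuous (fun _ : param => c) by exact: cst_continuous.
have Xc j : continuous (X ^~ j) by move=> x; exact: coord_continuous.
apply: pair_continuous.
  apply: continuous_mx => i k; under eq_fun do rewrite mxE.
  apply: continuous_add; last apply: sum_continuous => l; last exact: Xc.
  apply: continuous_add; first exact: cst_cont.
  apply: continuous_mul; last exact: cst_cont.
  apply: continuous_mul; last exact: cst_cont.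
  by apply: continuous_add; [exact: Xc|exact: cst_cont].
apply: continuous_mx => i k; under eq_fun do rewrite mxE.
case: unliftP => [l _|_]; last exact: cst_cont.
by apply: continuous_mul; [exact: cst_cont|exact: Xc].
Qed.

Let probe_continuous j : continuous (probe ^~ j).
Proof.
case: j => [[k i]|] /=.
  have entry_continuous l : continuous (fun z : loop => z.1 i l).
    move=> z; apply: (@continuous_comp _ _ _ (fun z : loop => z.1) (fun M : 'M[R]_(n, N.+1) => M i l)).
      exact: cvg_fst.
    exact: coord_continuous.
  exact: continuous_sub.
exact: (dot_continuous (@fst_col_continuous _ _ _ _) (fun=> cvg_cst _)).
Qed.

(** For a constant momentum the bilinear part telescopes around the loop. *)
Lemma action_constant_momentum z : (forall j, probe z j = 0) ->
  discrete_action alpha K z = 0.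
Proof.
move=> pz; have z0 : dot (col ord0 z.1) alpha = 0 by exact: pz None.
have zk k : col k z.1 = col ord0 z.1.
  case: k => k kN; elim: k kN => [|k IH] kN; first by congr (col _ _); exact: val_inj.
  rewrite -(IH (ltnW kN)); apply/colP => i; rewrite !mxE; apply/eqP.
  have := pz (Some (Ordinal (kN : (k < N)%N), i)) => /= /eqP; rewrite subr_eq0.
  by congr (z.1 i _ == z.1 i _); exact: val_inj.
rewrite /discrete_action zk z0 add0r [X in _ - _ * X]big1 => [|k _]; last by rewrite K_barrier// zk.
by rewrite mulr0 subr0 sum_by_parts big1// => k _; rewrite !zk subrr dot0l.
Qed.

Let ev (i : 'I_#|J|) : J := enum_val i.

Let evK j : ev (enum_rank j) = j.
Proof. exact: enum_rankK. Qed.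

(** Since [phi] fixes the loops of action at most [-1], it fixes the boundary of the
box of test loops, where the probes have the signs of the coordinates. By
[poincare_miranda] the image of the box contains a loop on which all probes vanish;
its action is 0 by [action_constant_momentum]. *)
Lemma linking (phi : loop -> loop) : continuous phi ->
  (forall z, discrete_action alpha K z <= -1 -> phi z = z) ->
  (forall z, discrete_action alpha K z <= s + 1 -> discrete_action alpha K (phi z) < 0) ->
  False.
Proof.
move=> phic phi_id phi_lt0.
pose f i (x : param) := probe (phi (test_loop x)) (ev i).
have lohi (i : 'I_#|J|) : lo (ev i) < hi (ev i).
  by case: (ev i) => [_|] /=; [rewrite gtrN|apply: lt_trans s_gt0]; rewrite ?oppr_lt0.
have boxP x : box (fun i : 'I_#|J| => lo (ev i)) (fun i => hi (ev i)) x -> in_box x.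
  by move=> bx j; have := bx (enum_rank j); rewrite /= in_itv /= evK.
have fE i x : in_box x -> x 0 i = lo (ev i) \/ x 0 i = hi (ev i) ->
    f i x = x 0 i.
  move=> bx xi; have XE : X x (ev i) = x 0 i by rewrite /X /ev enum_valK.
  rewrite /f phi_id ?probe_test//.
  by apply: (@action_test_boundary _ (ev i)) => //; rewrite XE.
have [||| x bx fx] := @poincare_miranda R _ _ _ lohi f _ _ _.
- move=> i x; apply: (@continuous_comp _ _ _ (phi \o test_loop) (probe^~ (ev i))).
    by apply: continuous_comp; [exact: test_loop_continuous|exact: phic].
  exact: probe_continuous.
- move=> i x bx xi; rewrite fE//; [|exact: boxP|by left].
  by rewrite xi; case: (ev i) => [_|] /=; rewrite oppr_lt0.
- move=> i x bx xi; rewrite fE//; [|exact: boxP|by right].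
  by rewrite xi; case: (ev i) => [_|] /=; rewrite ltW.
have := phi_lt0 (test_loop x) (action_test_le (boxP _ bx)).
rewrite action_constant_momentum ?ltxx// => j.
by have := fx (enum_rank j); rewrite /f evK.
Qed.

Hypothesis unif_diff : forall e : R, 0 < e -> exists2 d : R, 0 < d &
  forall z h : phase, `|h| <= d -> `|remainder K gp gq z h| <= e * `|h|.
Hypotheses (Kc : continuous K) (gpc : continuous gp) (gqc : continuous gq).

(** Otherwise [action_descent] and [deformation] would provide a deformation
excluded by [linking]. *)
Theorem near_critical_loop (delta : R) : 0 < delta ->
  exists z : loop, `|grad alpha gp gq z| < delta.
Proof.
move=> d0; apply: contrapT => nz.
have dg (z : loop) : delta <= `|grad alpha gp gq z|.
  by rewrite leNgt; apply/negP => zd; apply: nz; exists z.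
have [t0 t00 Ht0] := @action_descent _ _ _ alpha K gp gq unif_diff delta d0 dg.
have [||||phi [phic phi_id phi_lt]] := @deformation R _ (discrete_action alpha K)
  (fun z : loop => `|grad alpha gp gq z|^-1 *: grad alpha gp gq z) t0 (delta / 2) _ _ _ _ Ht0 (s + 1).
- exact: action_continuous.
- move=> z; apply: cvgZ; last exact: grad_continuous.
  apply: cvgV; first by rewrite gt_eqF// (lt_le_trans d0).
  by apply: cvg_norm; exact: grad_continuous.
- by [].
- by rewrite divr_gt0.
exact: linking phic phi_id phi_lt.
Qed.

End Linking.

(** * Pointwise limits of Euler polygons *)

(** Estimates of this form are stable under pointwise limits, which is how the
limit of the Euler polygons is differentiated. *)
Lemma is_derive_first_order (R : realType) (W : normedModType R) (x : R -> W) (s : R) (v : W) :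
  (forall e : R, 0 < e -> exists2 d : R, 0 < d &
    forall h, `|h| <= d -> `|x (s + h) - x s - h *: v| <= e * `|h|) ->
  is_derive s 1 x v.
Proof.
move=> xv.
have cv : (fun h : R => h^-1 *: ((x \o shift s) (h *: 1) - x s)) @ 0^' --> v.
  apply/cvgrPdist_le => e e0; have [d d0 Hd] := xv e e0.
  near=> h.
  have h0 : h != 0 by near: h; exact: nbhs_dnbhs_neq.
  have hd : `|h| <= d by near: h; exact: dnbhs0_le.
  rewrite distrC /= /shift /=.
  rewrite [X in `|X|](_ : _ = h^-1 *: (x (s + h) - x s - h *: v)); last first.
    rewrite [RHS]scalerBr scalerA mulVf// scale1r; congr (_ *: (x _ - _) - _).
    by rewrite addrC [h *: _]mulr1.
  rewrite normrZ normfV ler_pdivrMl ?normr_gt0// mulrC.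
  exact: Hd.
apply: DeriveDef; first by apply/cvg_ex; exists v.
exact: cvg_lim.
Unshelve. all: by end_near. Qed.

Lemma cV_ball_compact (R : realType) n (B : R) : compact [set v : 'cV[R]_n | `|v| <= B].
Proof.
have [B0|B0] := ltP B 0.
  rewrite (_ : [set _ | _] = set0); first exact: compact0.
  by apply/seteqP; split=> // v /= vB;
    have := le_lt_trans (normr_ge0 v) (le_lt_trans vB B0); rewrite ltxx.
pose K := [set v : 'rV[R]_n | forall i, `[- B, B]%classic (v ord0 i)].
have cK : compact K.
  exact: (@rV_compact R n (fun=> `[- B, B]%classic) (fun=> @segment_compact _ _ _)).
have ctr : continuous (trmx : 'rV[R]_n -> 'cV[R]_n).
  by apply: continuous_mx => i j; under eq_fun do rewrite mxE; exact: coord_continuous.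
rewrite (_ : [set _ | _] = trmx @` K); last first.
  apply/seteqP; split=> [v /= /(le_mx_norm _ B0) vB|v [u Ku <-]] /=.
    exists v^T; last exact: trmxK.
    by move=> i; rewrite /= mxE in_itv /= -ler_norml; exact: vB.
  apply/le_mx_norm => // i j; rewrite mxE (ord1 j) ler_norml.
  exact: Ku i.
by apply: continuous_compact => //; exact: continuous_subspaceT.
Qed.

Lemma phase_ball_compact (R : realType) n (B : R) :
  compact [set z : 'cV[R]_n * 'cV[R]_n | `|z| <= B].
Proof.
rewrite (_ : [set _ | _] = [set v | `|v| <= B] `*` [set v | `|v| <= B]).
  by apply: compact_setX; exact: cV_ball_compact.
by apply/seteqP; split=> [z|z [/=]] /=; rewrite pair_norm_le; [move/andP|move=> -> ->].
Qed.

(** In a compact set a sequence has a cluster point, and an ultrafilter that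
clusters at a point converges to it. Thus one ultrafilter serves for all times at
once. *)
Lemma ultra_cvg (T : topologicalType) (U : set_system nat) (z : nat -> T) (K : set T) :
  UltraFilter U -> compact K -> (forall N, K (z N)) ->
  exists x : T, z @ U --> x.
Proof.
move=> UU cK zK.
have zU : U (z @^-1` K) by apply: (filterS _ (@filterT _ U _)) => N _; exact: zK.
have [|x [_ clx]] := cK (z @ U) _; first exact: zU.
exists x => B xB; have [//|UB] := in_ultra_setVsetC (z @^-1` B) UU.
by have [y []] := clx (~` B) B UB xB.
Qed.

Section LimitCurve.
Variables (R : realType) (n : nat).
Notation phase := ('cV[R]_n * 'cV[R]_n)%type.
Variables (V : phase -> phase) (z : nat -> R -> phase) (w : phase).
Hypothesis Vc : continuous V.
Hypothesis z_bounded : forall t, exists B, forall N, `|z N t| <= B.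
Hypothesis z_periodic : forall N t, z N (t + 1) = z N t + w.
Hypothesis z_euler : forall e : R, 0 < e -> exists2 d : R, 0 < d &
  forall s t u : R, s <= t -> t - s <= d -> u = s \/ u = t ->
  exists C : R, \forall N \near \oo,
    `|z N t - z N s - (t - s) *: V (z N u)| <= (t - s) * e + C * N.+1%:R^-1.

(** The pointwise limit along an ultrafilter. The estimate [z_euler] involves only
the values at finitely many times, so it survives the pointwise limit. Allowing [u = t] in it is what gives derivatives from the left. *)
Lemma limit_curve : exists2 x : R -> phase, forall t, x (t + 1) = x t + w &
  forall e : R, 0 < e -> exists2 d : R, 0 < d &
    forall s h, `|h| <= d -> `|x (s + h) - x s - h *: V (x s)| <= e * `|h|.
Proof.
have [U [UU sU]] := ultraFilterLemma (eventually_filter : ProperFilter \oo).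
have lim t : exists x : phase, z ^~ t @ U --> x.
  have [B zB] := z_bounded t; exact: (@ultra_cvg _ U (z ^~ t) _ UU (@phase_ball_compact R n B) zB).
have [x xlim] := choice lim.
exists x => [t|e e0].
  have : z ^~ (t + 1) @ U --> x t + w.
    by under eq_fun do rewrite z_periodic; apply: cvgD; [exact: xlim|exact: cvg_cst].
  exact: (cvg_unique _ (xlim (t + 1))).
have [d d0 Hd] := z_euler e0; exists d => // s h hd.
have est a b u : a <= b -> b - a <= d -> u = a \/ u = b ->
    `|x b - x a - (b - a) *: V (x u)| <= (b - a) * e.
  move=> ab bad uab; have [C HC] := Hd a b u ab bad uab.
  apply: (@ler_cvg_to _ U _ _ (fun N => `|z N b - z N a - (b - a) *: V (z N u)|)
    (fun N => (b - a) * e + C * N.+1%:R^-1)); last exact: sU.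
    apply: cvg_norm; apply: cvgB; first by apply: cvgB; exact: xlim.
    apply: cvgZ; first exact: cvg_cst.
    by apply: (@continuous_cvg _ _ _ _ _ (fun N => z N u) V); [exact: Vc|exact: xlim].
  rewrite -[X in _ --> X]addr0 -[X in _ --> _ + X](mulr0 C).
  apply: cvgD; first exact: cvg_cst.
  apply: cvgM; first exact: cvg_cst.
  exact: (cvg_trans (cvg_app _ sU) (@cvg_harmonic R)).
have [h0|h0] := leP 0 h.
  have E : s + h - s = h by rewrite addrC addKr.
  have := est s (s + h) s; rewrite E lerDl (ger0_norm h0) mulrC; apply => //; last by left.
  exact: le_trans (ler_norm _) hd.
have E : s - (s + h) = - h by rewrite opprD addNKr.
have H : `|x s - x (s + h) - (- h) *: V (x s)| <= - h * e.
  rewrite -E; apply: est; [by rewrite gerDl ltW| |by right].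
  by rewrite E; apply: le_trans hd; rewrite -normrN ler_norm.
rewrite ltr0_norm// mulrC; apply: le_trans H.
by rewrite -[X in _ <= X]normrN scaleNr opprK opprD opprB.
Qed.

End LimitCurve.

(** * From discrete loops to Euler polygons *)

Section Unroll.
Variables (R : realType) (n N : nat) (alpha : 'cV[R]_n).
Notation phase := ('cV[R]_n * 'cV[R]_n)%type.
Notation loop := ('M[R]_(n, N.+1) * 'M[R]_(n, N.+1))%type.
Variables gp gq : phase -> 'cV[R]_n.
Hypothesis alpha_int : alpha \is a mxOver Num.int.
Hypothesis g_periodic : forall p q v, v \is a mxOver Num.int ->
  gp (p, q + v) = gp (p, q) /\ gq (p, q + v) = gq (p, q).

(** With [gp] and [gq] the partial gradients of a Hamiltonian in the momentum and in
the position, this is its Hamiltonian vector field. *)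
Definition ham_field (z : phase) : phase := (- gq z, gp z).

Definition site (k : int) : 'I_N.+1 := inord `|(k %% N.+1)%Z|%N.
Definition lap (k : int) : int := (k %/ N.+1)%Z.

Lemma site_lap (q : int) (r : 'I_N.+1) :
  site (q * N.+1%:Z + r%:Z) = r /\ lap (q * N.+1%:Z + r%:Z) = q.
Proof.
have rN : (0 <= r%:Z < N.+1%:Z) by rewrite /= ltz_nat ltn_ord.
split.
  by rewrite /site modzMDl modz_small//= inord_val.
by rewrite /lap divzMDl// divz_small ?addr0.
Qed.

Lemma int_site_lap k : exists q (r : 'I_N.+1), k = q * N.+1%:Z + r%:Z.
Proof.
exists (lap k), (site k); rewrite {1}(divz_eq k N.+1) /site; congr (_ + _).
have m0 : 0 <= (k %% N.+1)%Z by rewrite modz_ge0.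
rewrite inordK ?gez0_abs//.
by have := ltz_pmod k (isT : 0 < N.+1%:Z); lia.
Qed.

Lemma site_lap_succ k :
  site (k + 1) = ordS (site k) /\ lap (k + 1) = lap k + (site k == ord_max)%:Z.
Proof.
have [q [r ->]] := int_site_lap k; have [-> ->] := site_lap q r.
have [->|rmax] := eqVneq r ord_max.
  have -> : q * N.+1%:Z + (@ord_max N)%:Z + 1 = (q + 1) * N.+1%:Z + (@ord0 N)%:Z.
    by rewrite /=; lia.
  by have [-> ->] := site_lap (q + 1) ord0; split=> //; apply/val_inj; rewrite /= modnn.
have rN : (r.+1 < N.+1)%N.
  by rewrite ltn_neqAle ltn_ord andbT; apply: contra rmax => /eqP[rN]; apply/eqP/val_inj.
have -> : q * N.+1%:Z + r%:Z + 1 = q * N.+1%:Z + (Ordinal rN)%:Z by rewrite /=; lia.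
have [-> ->] := site_lap q (Ordinal rN); rewrite addr0; split=> //.
by apply/val_inj; rewrite /= modn_small.
Qed.

(** The bi-infinite sequence of lifted points of a discrete loop: [site] is the vertex
reached after [k] steps and [lap] the number of completed turns, each of which
shifts the position by [alpha]. The vector [v] chooses the lift. *)
Definition unroll (x : loop) (v : 'cV[R]_n) (k : int) : phase :=
  (col (site k) x.1, col (site k) x.2 + (lap k)%:~R *: alpha + v).

Lemma unroll_periodic x v k : unroll x v (k + N.+1%:Z) = unroll x v k + (0, alpha).
Proof.
have [q [r ->]] := int_site_lap k.
have -> : q * N.+1%:Z + r%:Z + N.+1%:Z = (q + 1) * N.+1%:Z + r%:Z by lia.
rewrite /unroll; have [-> ->] := site_lap q r; have [-> ->] := site_lap (q + 1) r.
rewrite [RHS](_ : _ = (col r x.1 + 0, col r x.2 + q%:~R *: alpha + v + alpha))//.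
rewrite addr0; congr (_, _); rewrite intrD scalerDl scale1r.
by apply/colP => i; rewrite !mxE; ring.
Qed.

Lemma scale_int (m : int) : (m%:~R *: alpha) \is a mxOver Num.int.
Proof.
by apply/mxOverP => i j; rewrite mxE rpredM ?intr_int//; exact: (mxOverP alpha_int).
Qed.

(** The two components of the gradient of the action are the defects in the
equations of the symplectic Euler scheme, in which the field is evaluated at the old
momentum and the new position. Periodicity removes the integral translations. *)
Lemma unroll_step x v k : v \is a mxOver Num.int ->
  `|unroll x v (k + 1) - unroll x v k
    - N.+1%:R^-1 *: ham_field ((unroll x v k).1, (unroll x v (k + 1)).2)|
  <= `|grad alpha gp gq x|.
Proof.
move=> v_int; rewrite /unroll /=; have [-> ->] := site_lap_succ k.
set r := site k; set p := col r x.1; set y := col (ordS r) x.2.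
have w_int : (lap k + (r == ord_max)%:Z)%:~R *: alpha + v \is a mxOver Num.int.
  apply/mxOverP => i j; rewrite mxE rpredD//; last exact: (mxOverP v_int).
  exact: (mxOverP (scale_int _)).
have [] := g_periodic p y w_int; rewrite addrA /ham_field => -> ->.
have -> : forall a b c d e f : 'cV[R]_n, (a, b) - (c, d) - N.+1%:R^-1 *: (e, f) =
   (a - c - N.+1%:R^-1 *: e, b - d - N.+1%:R^-1 *: f) by [].
have cg : `|grad alpha gp gq x| <= `|grad alpha gp gq x| by [].
move: cg; rewrite {1}pair_norm_le => /andP[g1 g2].
rewrite pair_norm_le /=; apply/andP; split.
  apply: le_trans g2; apply: le_trans (col_norm_le _ (ordS r)).
  rewrite col_of_entries /grad2 ordSK -/p -/y scalerN opprK -normrN opprD opprB.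
  exact: lexx.
apply: le_trans g1; apply: le_trans (col_norm_le _ r).
rewrite col_of_entries /grad1 -/p -/y intrD scalerDl.
rewrite [X in `|X| <= _](_ : _ = y - col r x.2 + (r == ord_max)%:R *: alpha
  - N.+1%:R^-1 *: gp (p, y))//.
have -> : ((r == ord_max)%:Z)%:~R = (r == ord_max)%:R :> R by case: (r == _).
by apply/colP => i; rewrite !mxE; ring.
Qed.

End Unroll.

Section Euler.
Variables (R : realType) (n N : nat).
Notation phase := ('cV[R]_n * 'cV[R]_n)%type.
Variables (V : phase -> phase) (Z : int -> phase) (M delta : R).
Let eps : R := N.+1%:R^-1.
Hypotheses (V_le : forall z, `|V z| <= M) (M_ge0 : 0 <= M).
Let mid (k : int) : phase := ((Z k).1, (Z (k + 1)).2).
Hypothesis step : forall k, `|Z (k + 1) - Z k - eps *: V (mid k)| <= delta.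
Hypotheses (delta_ge0 : 0 <= delta) (delta_le : delta <= eps ^+ 2).

Let eps_gt0 : 0 < eps. Proof. by rewrite invr_gt0. Qed.
Let eps_le1 : eps <= 1. Proof. by rewrite invf_le1// ler1n. Qed.
Let delta_le_eps : delta <= eps.
Proof.
apply: le_trans delta_le _; rewrite expr2; have := eps_gt0; have := eps_le1.
by move=> a b; rewrite ler_piMr// ltW.
Qed.

Lemma euler_step_le k : `|Z (k + 1) - Z k| <= eps * (M + 1).
Proof.
have -> : Z (k + 1) - Z k = (Z (k + 1) - Z k - eps *: V (mid k)) + eps *: V (mid k).
  by rewrite subrK.
apply: le_trans (ler_normD _ _) _; rewrite normrZ gtr0_norm//.
have := step k; have : eps * `|V (mid k)| <= eps * M by rewrite ler_wpM2l// ltW.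
by move: delta_le_eps; lra.
Qed.

Lemma euler_move k (j : nat) : `|Z (k + j%:Z) - Z k| <= j%:R * (eps * (M + 1)).
Proof.
elim: j => [|j IH]; first by rewrite addr0 subrr normr0 mul0r.
have -> : k + j.+1%:Z = k + j%:Z + 1 by lia.
have -> : Z (k + j%:Z + 1) - Z k = (Z (k + j%:Z + 1) - Z (k + j%:Z)) + (Z (k + j%:Z) - Z k).
  by rewrite addrA subrK.
apply: le_trans (ler_normD _ _) _; have := euler_step_le (k + j%:Z).
by rewrite -natr1; lra.
Qed.

Lemma mid_move k : `|mid k - Z k| <= eps * (M + 1).
Proof.
apply: le_trans (euler_step_le k); rewrite (pair_norm_le (mid k - Z k)) /= subrr normr0 normr_ge0 /=.
by have := lexx `|Z (k + 1) - Z k|; rewrite {1}(pair_norm_le (Z (k + 1) - Z k)) => /andP[].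
Qed.

(** The defects [delta] of the single steps and the deviations of the field from the
reference vector [W] add up. *)
Lemma euler_sum k (j : nat) W e :
  (forall i, (i < j)%N -> `|V (mid (k + i%:Z)) - W| <= e) ->
  `|Z (k + j%:Z) - Z k - (j%:R * eps) *: W| <= j%:R * (eps * e + delta).
Proof.
elim: j => [|j IH] He; first by rewrite addr0 subrr !mul0r scale0r subr0 normr0.
have -> : k + j.+1%:Z = k + j%:Z + 1 by lia.
have -> : Z (k + j%:Z + 1) - Z k - (j.+1%:R * eps) *: W =
    (Z (k + j%:Z) - Z k - (j%:R * eps) *: W) +
    ((Z (k + j%:Z + 1) - Z (k + j%:Z) - eps *: V (mid (k + j%:Z))) +
     eps *: (V (mid (k + j%:Z)) - W)).
  rewrite -natr1 mulrDl mul1r scalerDl scalerBr [X in _ = _ + X]addrA subrK.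
  by rewrite [RHS]addrC addrACA [X in _ = X + _]addrA subrK opprD [- _ - _]addrC.
apply: le_trans (ler_normD _ _) _.
have H1 := IH (fun i ij => He i (ltnW ij)).
have H2 := ler_normD (Z (k + j%:Z + 1) - Z (k + j%:Z) - eps *: V (mid (k + j%:Z)))
   (eps *: (V (mid (k + j%:Z)) - W)).
have H3 := step (k + j%:Z).
have H4 : `|eps *: (V (mid (k + j%:Z)) - W)| <= eps * e.
  by rewrite normrZ gtr0_norm// ler_wpM2l ?(ltW eps_gt0)// He.
rewrite -natr1; move: H1 H2 H3 H4; lra.
Qed.

Definition interpolate (t : R) : phase := Z (Num.floor (t * N.+1%:R)).

Lemma floor_diff (s t : R) : s <= t -> exists2 j : nat,
  Num.floor (t * N.+1%:R) = Num.floor (s * N.+1%:R) + j%:Z &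
  `|j%:R * eps - (t - s)| <= eps.
Proof.
move=> st; set a := Num.floor _; set b := Num.floor _.
have N0 : 0 < N.+1%:R :> R by rewrite ltr0Sn.
have ba : b <= a by rewrite le_floor// ler_wpM2r// ltW.
exists `|(a - b)%R|%N; first by lia.
have -> : `|(a - b)%R|%N%:R = a%:~R - b%:~R :> R.
  have ab : `|(a - b)%R|%N%:Z = a - b by rewrite gez0_abs ?subr_ge0.
  by rewrite -intrB -[in RHS]ab.
have [a1 a2] : a%:~R <= t * N.+1%:R /\ t * N.+1%:R < a%:~R + 1.
  by split; [exact: floor_le|rewrite -intrD1; exact: floorD1_gt].
have [b1 b2] : b%:~R <= s * N.+1%:R /\ s * N.+1%:R < b%:~R + 1.
  by split; [exact: floor_le|rewrite -intrD1; exact: floorD1_gt].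
have -> : (a%:~R - b%:~R) * eps - (t - s) =
    ((a%:~R - b%:~R) - (t - s) * N.+1%:R) * eps.
  by rewrite [RHS]mulrBl mulfK// gt_eqF.
rewrite normrM (gtr0_norm eps_gt0) ler_piMl ?(ltW eps_gt0)// ler_norml.
by apply/andP; split; lra.
Qed.

(** Between the times [s] and [t] the polygon remains so close to [interpolate u]
that the field varies by at most [e]; then [euler_sum] applies with [W] the field at
[interpolate u]. The terms in [eps] come from rounding the times to the grid. *)
Lemma interpolate_euler (e d s t u : R) :
  (forall z z', `|z - z'| <= d -> `|V z - V z'| <= e) -> 0 <= e ->
  s <= t -> (t - s + 2 * eps) * (M + 1) <= d -> u = s \/ u = t ->
  `|interpolate t - interpolate s - (t - s) *: V (interpolate u)|
    <= (t - s) * e + (e + (t - s) + 1 + M) * eps.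
Proof.
move=> ucV e0 st std su; have [j tE jE] := floor_diff st.
set a := Num.floor (s * N.+1%:R) in tE.
have sE : interpolate s = Z a by [].
have {}tE : interpolate t = Z (a + j%:Z) by rewrite /interpolate tE.
have jle : j%:R * eps <= t - s + eps by move: jE; rewrite ler_norml; lra.
have M1 : 0 <= M + 1 by rewrite addr_ge0.
have jM : j%:R * (eps * (M + 1)) <= (t - s + eps) * (M + 1).
  by rewrite mulrA ler_wpM2r.
have near i : (i < j)%N -> `|V (mid (a + i%:Z)) - V (interpolate u)| <= e.
  move=> ij; apply: ucV; apply: le_trans std.
  have -> : mid (a + i%:Z) - interpolate u =
     (mid (a + i%:Z) - Z (a + i%:Z)) + (Z (a + i%:Z) - interpolate u).
    by rewrite addrA subrK.
  apply: le_trans (ler_normD _ _) _; have := mid_move (a + i%:Z).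
  suff : `|Z (a + i%:Z) - interpolate u| <= j%:R * (eps * (M + 1)) by lra.
  have le_j (i' : nat) : (i' <= j)%N -> i'%:R * (eps * (M + 1)) <= j%:R * (eps * (M + 1)).
    by move=> ij'; rewrite ler_wpM2r ?ler_nat// mulr_ge0// ltW.
  case: su => ->.
    by rewrite sE; apply: le_trans (euler_move _ _) _; apply: le_j; exact: ltnW.
  have E : a + j%:Z = a + i%:Z + (j - i)%N%:Z.
    by rewrite -addrA -PoszD subnKC// ltnW.
  rewrite tE E distrC.
  by apply: le_trans (euler_move _ _) _; apply: le_j; exact: leq_subr.
have := euler_sum near; rewrite -tE -sE => H.
have -> : interpolate t - interpolate s - (t - s) *: V (interpolate u) =
   (interpolate t - interpolate s - (j%:R * eps) *: V (interpolate u)) +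
   (j%:R * eps - (t - s)) *: V (interpolate u).
  by rewrite [X in _ = _ + X]scalerBl addrA subrK.
apply: le_trans (ler_normD _ _) _; rewrite normrZ.
have H2 : `|j%:R * eps - (t - s)| * `|V (interpolate u)| <= eps * M by exact: ler_pM.
have H3 : j%:R * eps * e <= (t - s + eps) * e by rewrite ler_wpM2r.
have H4 : j%:R * delta <= (t - s + 1) * eps.
  apply: (@le_trans _ _ (j%:R * eps * eps)).
    by rewrite -mulrA -expr2 ler_wpM2l.
  apply: ler_wpM2r; first exact: ltW.
  by move: jle eps_le1; lra.
move: H H2 H3 H4; lra.
Qed.

Lemma interpolate_le t : `|interpolate t| <= `|Z 0| + (`|t| + 1) * (M + 1).
Proof.
have M1 : 0 <= M + 1 by rewrite addr_ge0.
have bound (j : nat) : j%:R * eps <= `|t| + 1 -> j%:R * (eps * (M + 1)) <= (`|t| + 1) * (M + 1).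
  by move=> jt; rewrite mulrA ler_wpM2r.
have Z0 : interpolate 0 = Z 0 by rewrite /interpolate mul0r floor0.
have [t0|t0] := leP 0 t.
  have [j tE jE] := floor_diff t0; rewrite subr0 in jE.
  have -> : interpolate t = Z 0 + (Z (0 + j%:Z) - Z 0).
    by rewrite addrC subrK /interpolate tE mul0r floor0.
  apply: le_trans (ler_normD _ _) _; rewrite lerD2l; apply: le_trans (euler_move _ _) _.
  by apply: bound; move: jE; rewrite ler_norml ger0_norm//; move: eps_le1; lra.
have [j tE jE] := floor_diff (ltW t0); rewrite sub0r in jE.
have -> : interpolate t = Z 0 - (Z (Num.floor (t * N.+1%:R) + j%:Z) - interpolate t).
  by rewrite -tE mul0r floor0 opprB addrC subrK.
apply: le_trans (ler_normB _ _) _; rewrite lerD2l; apply: le_trans (euler_move _ _) _.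
by apply: bound; move: jE; rewrite ler_norml ltr0_norm//; move: eps_le1; lra.
Qed.

Lemma interpolate_periodic w t : (forall k, Z (k + N.+1%:Z) = Z k + w) ->
  interpolate (t + 1) = interpolate t + w.
Proof.
move=> Zw; rewrite -Zw /interpolate mulrDl mul1r; congr (Z _).
by rewrite -[N.+1%:R]/((N.+1%:Z)%:~R) floorDrz ?intrKfloor ?intr_int.
Qed.

End Euler.

(** * Periodic solutions *)

Lemma integer_translate (R : realType) n (q : 'cV[R]_n) :
  exists2 v : 'cV[R]_n, v \is a mxOver Num.int & `|q + v| <= 1.
Proof.
exists (\col_i (- Num.floor (q i 0))%:~R).
  by apply/mxOverP => i j; rewrite mxE intr_int.
apply/le_mx_norm => // i j; rewrite (ord1 j) !mxE mulrNz; set y := q _ _.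
have a1 := floor_le y; have a2 := floorD1_gt y; rewrite intrD1 in a2.
by rewrite ger0_norm ?subr_ge0//; lra.
Qed.

Section PeriodicOrbit.
Variables (R : realType) (n : nat) (alpha : 'cV[R]_n).
Notation phase := ('cV[R]_n * 'cV[R]_n)%type.
Variables (gp gq : phase -> 'cV[R]_n) (M R0 : R).
Let V := ham_field gp gq.
Hypotheses (alpha_int : alpha \is a mxOver Num.int) (alpha_neq0 : alpha != 0).
Hypothesis g_periodic : forall p q v, v \is a mxOver Num.int ->
  gp (p, q + v) = gp (p, q) /\ gq (p, q + v) = gq (p, q).
Hypothesis V_le : forall z, `|V z| <= M.
Hypothesis V_unif : forall e : R, 0 < e -> exists2 d : R, 0 < d &
  forall z z', `|z - z'| <= d -> `|V z - V z'| <= e.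
Hypotheses (R0_ge0 : 0 <= R0) (V_supp : forall z, R0 < `|z.1| -> V z = 0).
Hypothesis near_critical : forall N (delta : R), 0 < delta ->
  exists x : 'M[R]_(n, N.+1) * 'M[R]_(n, N.+1), `|grad alpha gp gq x| < delta.

Let M_ge0 : 0 <= M. Proof. exact: le_trans (V_le 0). Qed.

Let kappa : R := Num.min 1 (`|alpha| / 2).
Let kappa_gt0 : 0 < kappa.
Proof. by rewrite lt_min ltr01 divr_gt0// normr_gt0. Qed.

(** The square makes the total defect of one turn, [N.+1%:R * tol N], tend to 0; the
factor [kappa] keeps it below the norm of [alpha]. *)
Let tol N : R := kappa * N.+1%:R^-1 ^+ 2.
Let tol_gt0 N : 0 < tol N.
Proof. by rewrite mulr_gt0// exprn_gt0// invr_gt0. Qed.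
Let tol_le N : tol N <= N.+1%:R^-1 ^+ 2.
Proof. by rewrite ler_piMl ?sqr_ge0// ge_min lexx. Qed.

(** The initial points must stay bounded as [N] grows. The position is normalised by
an integral translation. If the initial momentum were far from the support, the
momentum could not reach the support within one turn, so the field would vanish along
the whole polygon and the position could not advance by [alpha]. *)
Let sequences N : exists Z : int -> phase,
  [/\ forall k, `|Z (k + 1) - Z k - N.+1%:R^-1 *: V ((Z k).1, (Z (k + 1)).2)| <= tol N,
      forall k, Z (k + N.+1%:Z) = Z k + (0, alpha) & `|Z 0| <= R0 + M + 2].
Proof.
have [x gx] := near_critical N (tol_gt0 N).
have [v v_int qv] := integer_translate (col (site N 0) x.2).
pose Z := unroll alpha x v.
have Zstep k : `|Z (k + 1) - Z k - N.+1%:R^-1 *: V ((Z k).1, (Z (k + 1)).2)| <= tol N.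
  exact: le_trans (unroll_step alpha_int g_periodic _ _ v_int) (ltW gx).
have Zper k : Z (k + N.+1%:Z) = Z k + (0, alpha) by exact: unroll_periodic.
exists Z; split=> //.
rewrite pair_norm_le; apply/andP; split.
  apply: (@le_trans _ _ (R0 + M + 1)); last by lra.
  rewrite leNgt; apply/negP => Z0.
  have half (a : R) : 0 < a -> a / 2 < a by lra.
  have far_from (a b : 'cV[R]_n) : R0 + M + 1 < `|b| -> `|a - b| <= M + 1 -> R0 < `|a|.
    by have := lerB_dist b a; rewrite (distrC b); lra.
  have far i : (i < N.+1)%N -> V ((Z (0 + i%:Z)).1, (Z (0 + i%:Z + 1)).2) = 0.
    move=> iN; apply: V_supp; rewrite -[X in `|X|]/((Z (0 + i%:Z)).1).
    have := euler_move V_le M_ge0 Zstep (ltW (tol_gt0 N)) (tol_le N) 0 i.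
    have i1 : i%:R * N.+1%:R^-1 <= 1 :> R.
      by rewrite ler_pdivrMr ?ltr0Sn// mul1r ler_nat ltnW.
    have : i%:R * N.+1%:R^-1 * (M + 1) <= M + 1 by rewrite ler_piMl// addr_ge0.
    rewrite mulrA (pair_norm_le (Z _ - Z _)) => iM /andP[Zi _].
    rewrite -[X in `|X|]/((Z (0 + i%:Z)).1 - (Z 0).1) in Zi.
    exact: far_from Z0 (le_trans Zi iM).
  have H i : (i < N.+1)%N -> `|V ((Z (0 + i%:Z)).1, (Z (0 + i%:Z + 1)).2) - 0| <= 0.
    by move=> iN; rewrite far// subrr normr0.
  have := @euler_sum _ _ N V Z M (tol N) M_ge0 Zstep (ltW (tol_gt0 N)) (tol_le N) 0 N.+1 0 0 H.
  rewrite scaler0 subr0 Zper addrC addKr mulr0 add0r.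
  rewrite (pair_norm_le ((0 : 'cV[R]_n), alpha)) => /andP[_ /=].
  have -> : N.+1%:R * tol N = kappa * N.+1%:R^-1.
    by rewrite /tol expr2 mulrCA mulVKf ?pnatr_eq0.
  apply/negP; rewrite -ltNge.
  apply: (@le_lt_trans _ _ kappa).
    by rewrite ler_piMr ?(ltW kappa_gt0)// invf_le1// ler1n.
  by rewrite gt_min; apply/orP; right; apply: half; rewrite normr_gt0.
rewrite /Z /unroll /= (_ : lap N 0 = 0); last by rewrite /lap div0z.
by rewrite scale0r addr0 (le_trans qv)// -[leLHS]add0r lerD ?ler1n// addr_ge0.
Qed.

(** The polygons of [sequences], which have smaller and smaller defects, satisfy the
hypotheses of [limit_curve]. *)
Theorem periodic_orbit : exists2 x : R -> phase, forall t, x (t + 1) = x t + (0, alpha) &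
  forall e : R, 0 < e -> exists2 d : R, 0 < d &
    forall s h, `|h| <= d -> `|x (s + h) - x s - h *: V (x s)| <= e * `|h|.
Proof.
have [Z HZ] := choice sequences.
pose z N := interpolate N (Z N).
apply: (@limit_curve _ _ V z).
- move=> x; apply/cvgrPdist_le => e e0; have [d d0 Hd] := V_unif e0.
  near=> y; apply: Hd; near: y.
  exact: cvgr_dist_le d0.
- move=> t; exists (R0 + M + 2 + (`|t| + 1) * (M + 1)) => N.
  have [st _ Z0] := HZ N.
  by apply: le_trans (interpolate_le V_le M_ge0 st (ltW (tol_gt0 N)) (tol_le N) t) _; rewrite lerD2r.
- by move=> N t; have [_ per _] := HZ N; exact: interpolate_periodic.
move=> e e0; have [d d0 Hd] := V_unif e0.
have M1 : 0 < M + 1 by rewrite ltr_wpDl.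
exists (d / 2 / (M + 1)); first by rewrite !divr_gt0.
move=> s t u st std su; exists (e + (t - s) + 1 + M).
have d4 : 0 < d / 4 / (M + 1) by rewrite !divr_gt0.
near=> N.
have [stp _ _] := HZ N.
apply: (interpolate_euler V_le M_ge0 stp (ltW (tol_gt0 N)) (tol_le N) Hd (ltW e0) st _ su).
have : N.+1%:R^-1 < d / 4 / (M + 1).
  by near: N; exact: (near_infty_natSinv_lt (PosNum d4)).
have arith (a b c : R) : a * c <= d / 2 -> b * c < d / 4 -> (a + 2 * b) * c <= d by lra.
by move: std; rewrite ler_pdivlMr// ltr_pdivlMr//; exact: arith.
Unshelve. all: by end_near. Qed.

End PeriodicOrbit.

(** * Uniform continuity, chain rule and a cutoff function *)

Lemma is_derive_comp_curve (R : realType) (V W : normedModType R) (g : V -> W)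
    (x : R -> V) (t : R) (v : V) :
  differentiable g (x t) -> is_derive t 1 x v ->
  is_derive t 1 (g \o x) ('d g (x t) v).
Proof.
move=> dg dx; have [/derivable1_diffP diffx xv] := dx.
apply: DeriveDef.
  by apply/derivable1_diffP; exact: differentiable_comp.
rewrite deriveE; last exact: differentiable_comp.
by rewrite diff_comp//= -xv deriveE.
Qed.

Section PeriodicCompactSupport.
Variables (R : realType) (n : nat) (W : normedModType R).
Notation phase := ('cV[R]_n * 'cV[R]_n)%type.
Variables (Phi : phase -> W) (R0 : R).
Hypothesis Phi_continuous : continuous Phi.
Hypothesis Phi_periodic : forall p q v, v \is a mxOver Num.int -> Phi (p, q + v) = Phi (p, q).
Hypotheses (R0_ge0 : 0 <= R0) (Phi_supp : forall z, R0 < `|z.1| -> Phi z = 0).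

Lemma periodic_bounded : exists M, forall z, `|Phi z| <= M.
Proof.
have cPhi : compact (Phi @` [set z : phase | `|z| <= R0 + 1]).
  apply: continuous_compact; last exact: phase_ball_compact.
  exact: continuous_subspaceT.
have [M0 [_ HM]] := compact_bounded cPhi.
exists (`|M0| + 1) => -[p q].
have [pR|pR] := ltP R0 `|p|; first by rewrite Phi_supp// normr0 addr_ge0.
have [v v_int qv] := integer_translate q.
rewrite -(Phi_periodic p q v_int); apply: HM.
  by rewrite (le_lt_trans (ler_norm _))// ltrDl.
exists (p, q + v) => //=; rewrite (pair_norm_le (p, q + v)) /=.
by apply/andP; split; [apply: le_trans pR _; rewrite lerDl|apply: le_trans qv _; rewrite lerDr].
Qed.

(** Modulo integral translations every pair of close points is either outside the
support or in a fixed compact ball, where the Heine-Cantor argument applies. *)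
Lemma periodic_unif_continuous (e : R) : 0 < e -> exists2 d : R, 0 < d &
  forall z z', `|z - z'| <= d -> `|Phi z - Phi z'| <= e.
Proof.
move=> e0; apply: contrapT => nd.
have far_from (a b : 'cV[R]_n) (c : R) : R0 + 2 < `|a| -> `|a - b| <= c -> c <= 1 -> R0 < `|b|.
  by have := lerB_dist a b; lra.
have bad N : exists zz : phase * phase, [/\ `|zz.1| <= R0 + 2, `|zz.1 - zz.2| <= N.+1%:R^-1 &
    e < `|Phi zz.1 - Phi zz.2|].
  apply: contrapT => nbad; apply: nd; exists N.+1%:R^-1; first by rewrite invr_gt0.
  move=> [p q] [p' q'] zz'; rewrite leNgt; apply/negP => ePhi; apply: nbad.
  have [v v_int qv] := integer_translate q.
  exists ((p, q + v), (p', q' + v)) => /=.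
  have N1 : N.+1%:R^-1 <= 1 :> R by rewrite invf_le1// ler1n.
  rewrite !Phi_periodic//; split=> //.
    have pp' : `|p - p'| <= N.+1%:R^-1.
      by move: zz'; rewrite (pair_norm_le (p - p', q - q')) => /andP[].
    rewrite (pair_norm_le (p, q + v)) /=; apply/andP; split; last first.
      by apply: le_trans qv _; move: R0_ge0; lra.
    rewrite leNgt; apply/negP => pR.
    have pR1 : R0 < `|p| by move: pR; lra.
    have pR2 : R0 < `|p'| by exact: far_from pR pp' N1.
    move: ePhi; rewrite (Phi_supp (z := (p, q)))// (Phi_supp (z := (p', q')))//.
    by rewrite subrr normr0 ltNge ltW.
  have -> : (p, q + v) - (p', q' + v) = (p, q) - (p', q') :> phase.
    by congr pair; rewrite //= opprD addrACA subrr addr0.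
  exact: zz'.
have [zz Hzz] := choice bad.
have [U [UU sU]] := ultraFilterLemma (eventually_filter : ProperFilter \oo).
have [z zlim] := @ultra_cvg _ U (fun N => (zz N).1) _ UU (@phase_ball_compact R n (R0 + 2))
  (fun N => let: And3 a _ _ := Hzz N in a).
have z'lim : (fun N => (zz N).2) @ U --> z.
  rewrite [X in X @ U](_ : _ = (fun N => (zz N).1 - ((zz N).1 - (zz N).2))); last first.
    by apply/funext => N; rewrite opprB addrC subrK.
  rewrite -[X in _ --> X]subr0; apply: cvgB => //.
  apply: (cvg_trans (cvg_app _ sU)); apply/cvgr0Pnorm_le => d d0; near=> N.
  have [_ a _] := Hzz N; apply: le_trans a _.
  by near: N; have := near_infty_natSinv_lt (PosNum d0); apply: filterS => N /ltW.
have Plim : (fun N => Phi (zz N).1 - Phi (zz N).2) @ U --> Phi z - Phi z.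
  apply: cvgB.
    by apply: (@continuous_cvg _ _ _ _ _ (fun N => (zz N).1) Phi) => //; exact: Phi_continuous.
  by apply: (@continuous_cvg _ _ _ _ _ (fun N => (zz N).2) Phi) => //; exact: Phi_continuous.
rewrite subrr in Plim.
have /cvgr0Pnorm_le/(_ e e0) nPlim := Plim.
have [N] : exists N, `|Phi (zz N).1 - Phi (zz N).2| <= e by exact: filter_ex nPlim.
by have [_ _] := Hzz N; rewrite ltNge => /negP.
Unshelve. all: by end_near. Qed.

End PeriodicCompactSupport.

Section Cutoff.
Variable R : realType.
Implicit Types t : R.

Definition pos_sqr t : R := Num.max t 0 ^+ 2.

Lemma pos_sqr_first_order t h :
  `|pos_sqr (t + h) - pos_sqr t - h * (2 * Num.max t 0)| <= h ^+ 2.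
Proof.
rewrite /pos_sqr ler_norml; apply/andP.
have [a|a] := leP t 0; have [b|b] := leP (t + h) 0; split; nra.
Qed.

Lemma is_derive_pos_sqr t : is_derive t 1 pos_sqr (2 * Num.max t 0).
Proof.
apply: is_derive_first_order => e e0; exists e => // h he.
apply: le_trans (pos_sqr_first_order t h) _.
by rewrite -[h ^+ 2]real_normK ?num_real// expr2 ler_wpM2r.
Qed.

(** A function of class [C^1] that goes from 0 to 1 on the interval [[0, 1]] and is
constant elsewhere; the square of the positive part gives its derivative in closed
form. *)
Definition C1_step t : R := 1 - pos_sqr (1 - pos_sqr t).
Definition C1_step' t : R := 4 * Num.max (1 - pos_sqr t) 0 * Num.max t 0.

Lemma is_derive_C1_step t : is_derive t 1 C1_step (C1_step' t).
Proof.
have sub1 (g : R -> R) (u dg : R) : is_derive u 1 g dg -> is_derive u 1 (fun t => 1 - g t) (- dg).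
  move=> d; rewrite (_ : (fun t => 1 - g t) = cst 1 - g); last exact/funext.
  by apply: is_derive_eq; rewrite sub0r.
have d1 := is_derive_pos_sqr t.
have d2 := sub1 _ _ _ d1.
have d3 := is_derive_pos_sqr (1 - pos_sqr t).
have d4 := @is_derive1_comp R pos_sqr (fun t => 1 - pos_sqr t) t _ _ d3 d2.
apply: (is_derive_eq (sub1 _ _ _ d4)); rewrite /C1_step'; ring.
Qed.
End Cutoff.

(** * Closed orbits with energy in a given interval *)

Section CutoffProfile.
Variables (R : realType) (a b c : R).
Hypotheses (ab : a < b) (c_gt0 : 0 < c).

Definition cutoff (t : R) : R := c * C1_step ((t - a) / (b - a)).
Definition cutoff' (t : R) : R := c / (b - a) * C1_step' ((t - a) / (b - a)).

Let ba_gt0 : 0 < b - a. Proof. by rewrite subr_gt0. Qed.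

Lemma is_derive_cutoff (t : R) : is_derive t 1 cutoff (cutoff' t).
Proof.
have aff : is_derive t 1 (fun t : R => (t - a) / (b - a)) ((b - a)^-1).
  apply: is_derive_first_order => e e0; exists 1 => // h _.
  rewrite (_ : _ - _ = 0) ?normr0 ?mulr_ge0 ?(ltW e0)//.
  by rewrite /GRing.scale /=; ring.
have := @is_derive1_comp R (@C1_step R) (fun t => (t - a) / (b - a)) t _ _
  (is_derive_C1_step _) aff.
move=> d; have := is_deriveZ c d.
by move=> dc; apply: (is_derive_eq dc); rewrite /cutoff' /GRing.scale /=; ring.
Qed.

Lemma cutoff_eq0 t : t <= a -> cutoff t = 0.
Proof.
move=> ta; rewrite /cutoff /C1_step /pos_sqr.
rewrite [Num.max (_ / _) 0]max_r; last by rewrite pmulr_lle0 ?invr_gt0// subr_le0.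
by rewrite expr0n subr0 max_l ?ler01// expr1n subrr mulr0.
Qed.

Lemma cutoff_eq_top t : b <= t -> cutoff t = c.
Proof.
move=> bt; rewrite /cutoff /C1_step /pos_sqr.
have t1 : 1 <= (t - a) / (b - a) by rewrite ler_pdivlMr// mul1r lerD2r.
rewrite [Num.max (_ / _) 0]max_l; last exact: le_trans t1.
by rewrite max_r ?expr0n ?subr0 ?mulr1// subr_le0 exprn_ege1.
Qed.

Lemma cutoff_ge0 t : 0 <= cutoff t.
Proof.
rewrite mulr_ge0 ?(ltW c_gt0)// /C1_step subr_ge0 /pos_sqr.
have sq (u : R) : 0 <= Num.max u 0 ^+ 2 by exact: sqr_ge0.
by rewrite expr_le1// ?le_max ?lexx ?orbT// ge_max ler01 andbT lerBlDr lerDl.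
Qed.

Lemma cutoff'_ge0 t : 0 <= cutoff' t.
Proof.
by rewrite /cutoff' /C1_step' !mulr_ge0 ?invr_ge0 ?le_max ?lexx ?orbT// ltW.
Qed.

Lemma cutoff'_neq0 t : cutoff' t != 0 -> a < t < b.
Proof.
apply: contraR; rewrite negb_and -!leNgt => /orP[ta|bt].
  rewrite /cutoff' /C1_step' [Num.max (_ / _) 0]max_r ?mulr0//.
  by rewrite pmulr_lle0 ?invr_gt0// subr_le0.
have t1 : 1 <= (t - a) / (b - a) by rewrite ler_pdivlMr// mul1r lerD2r.
rewrite /cutoff' /C1_step' [Num.max (1 - _) 0]max_r ?mulr0 ?mul0r ?mulr0//.
by rewrite subr_le0 /pos_sqr max_l ?exprn_ege1// (le_trans _ t1).
Qed.

Lemma cutoff'_continuous : continuous cutoff'.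
Proof.
have maxc (f : R -> R) : continuous f -> continuous (fun t => Num.max (f t) 0).
  move=> fc t; apply: (@continuous_max R R f (fun=> 0)); first exact: fc.
  exact: cvg_cst.
have affc : continuous (fun t : R => (t - a) / (b - a)).
  by apply: continuous_mul; [apply: continuous_sub|]; move=> ?;
    [exact: cvg_id|exact: cvg_cst|exact: cvg_cst].
have cstc (k : R) : continuous (fun _ : R => k) by move=> ?; exact: cvg_cst.
apply: continuous_mul; first exact: cstc.
apply: continuous_mul; last exact: maxc.
apply: continuous_mul; first exact: cstc.
apply: (maxc _ _); apply: continuous_sub; first exact: cstc.
by apply: continuous_mul; exact: (maxc _ affc).
Qed.

End CutoffProfile.

Lemma twice_mul_le (R : realType) (k l : R) : 0 <= l -> k * l + k * l <= (2 * k + 1) * l.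
Proof. lra. Qed.

Lemma is_derive_rescale (R : realType) (W : normedModType R) (x : R -> W) (k t : R) (v : W) :
  is_derive (t * k) 1 x v -> is_derive t 1 (fun t : R => x (t * k)) (k *: v).
Proof.
move=> dx; have [/derivable1_diffP dfx <-] := dx.
have lin : is_derive t 1 (fun t : R => t * k) k.
  apply: is_derive_first_order => e e0; exists 1 => // h _.
  rewrite (_ : _ - _ = 0) ?normr0 ?mulr_ge0 ?(ltW e0)//.
  by rewrite /GRing.scale /=; ring.
have d := is_derive_comp_curve (x := fun t : R => t * k) dfx lin.
apply: (is_derive_eq d).
by rewrite deriveE// -linearZ /=; congr ('d x _ _); rewrite /GRing.scale /= mulr1.
Qed.

Section OrbitBetween.
Variables (R : realType) (n : nat).
Notation phase := ('cV[R]_n * 'cV[R]_n)%type.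
Variables (F : phase -> R) (alpha pstar : 'cV[R]_n) (R0 a b m : R).
Hypotheses (F_continuous : continuous F) (F_diff : forall z, differentiable F z).
Hypothesis dF_continuous : forall v, continuous (fun z => 'D_v F z).
Hypothesis F_periodic : forall p q v, v \is a mxOver Num.int -> F (p, q + v) = F (p, q).
Hypotheses (R0_ge0 : 0 <= R0) (F_supp : forall z, R0 < `|z.1| -> F z = 0).
Hypotheses (alpha_int : alpha \is a mxOver Num.int).
Hypothesis F_cone : forall z, F z != 0 -> 0 < dot z.1 alpha.
Hypotheses (a_gt0 : 0 < a) (ab : a < b) (bm : b < m) (F_pstar : forall q, m <= F (pstar, q)).

Let s := dot pstar alpha.
Let s_gt0 : 0 < s.
Proof.
apply: (F_cone (z := (pstar, 0))); rewrite gt_eqF//.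
by apply: lt_le_trans (F_pstar 0); apply: lt_trans bm; exact: lt_trans ab.
Qed.

(* s + 2 beats the value s of the linear term at pstar by enough to absorb the
   momentum increments, which cost at most 1, and to leave an action at most -1 *)
Let f := cutoff a b (s + 2).
Let f' := cutoff' a b (s + 2).
Let c_gt0 : 0 < s + 2. Proof. by rewrite addr_gt0. Qed.

Let K (z : phase) := f (F z).
Let gp (z : phase) := f' (F z) *: grad_p F z.
Let gq (z : phase) := f' (F z) *: grad_q F z.

(** [F] is differentiable, so its differential is determined by its values on the
canonical basis, which are the partial derivatives. *)
Lemma differential_grad z h :
  'd F z h = dot (grad_p F z) h.1 + dot (grad_q F z) h.2.
Proof.
have fst_sum (I : Type) (r : seq I) (g : I -> 'cV[R]_n) :
    ((\sum_(i <- r) g i, 0) : phase) = \sum_(i <- r) (g i, 0).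
  exact: (big_morph (fun x : 'cV[R]_n => (x, 0) : phase)
    (fun x y => congr1 (pair (x + y)) (esym (addr0 0))) erefl).
have snd_sum (I : Type) (r : seq I) (g : I -> 'cV[R]_n) :
    ((0, \sum_(i <- r) g i) : phase) = \sum_(i <- r) (0, g i).
  exact: (big_morph (fun x : 'cV[R]_n => (0, x) : phase)
    (fun x y => congr1 (fun u => (u, x + y)) (esym (addr0 0))) erefl).
have colsum (v : 'cV[R]_n) : v = \sum_i v i 0 *: (delta_mx i 0 : 'cV[R]_n).
  apply/colP => j; rewrite summxE (bigD1 j)//= !mxE !eqxx mulr1 big1 ?addr0// => i ij.
  by rewrite !mxE eq_sym (negPf ij) mulr0.
have hE : h = \sum_i h.1 i 0 *: ((delta_mx i 0 : 'cV[R]_n), (0 : 'cV[R]_n)) +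
   \sum_i h.2 i 0 *: ((0 : 'cV[R]_n), (delta_mx i 0 : 'cV[R]_n)).
  transitivity (((h.1, 0) : phase) + (0, h.2)).
    by case: h => x y; congr pair; rewrite /= ?addr0 ?add0r.
  rewrite {1}(colsum h.1) {1}(colsum h.2) fst_sum snd_sum.
  by congr (_ + _); apply: eq_bigr => i _; congr pair; rewrite /= scaler0.
rewrite {1}hE linearD !linear_sum; congr (_ + _); apply: eq_bigr => i _.
  by rewrite linearZ /= mxE deriveE// mulrC.
by rewrite linearZ /= mxE deriveE// mulrC.
Qed.

Lemma derive_periodic w p q v : v \is a mxOver Num.int ->
  'D_w F (p, q + v) = 'D_w F (p, q).
Proof.
move=> v_int; rewrite /derive.
have E (h : R) : F (h *: w + (p, q + v)) = F (h *: w + (p, q)).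
  rewrite -[RHS](F_periodic _ _ v_int); congr F.
  by congr pair; rewrite /= addrA.
have -> // : (fun h : R => h^-1 *: ((F \o shift (p, q + v)) (h *: w) - F (p, q + v))) =
    (fun h : R => h^-1 *: ((F \o shift (p, q)) (h *: w) - F (p, q))).
by apply/funext => h; congr (_ *: (_ - _)); [exact: E|exact: F_periodic].
Qed.

Lemma grad_periodic p q v : v \is a mxOver Num.int ->
  grad_p F (p, q + v) = grad_p F (p, q) /\ grad_q F (p, q + v) = grad_q F (p, q).
Proof.
by move=> v_int; split; apply/colP => i; rewrite !mxE derive_periodic.
Qed.

Lemma grad_p_continuous : continuous (grad_p F).
Proof.
by apply: continuous_mx => i j; under eq_fun do rewrite mxE; exact: dF_continuous.
Qed.

Lemma grad_q_continuous : continuous (grad_q F).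
Proof.
by apply: continuous_mx => i j; under eq_fun do rewrite mxE; exact: dF_continuous.
Qed.

Let f'F_continuous : continuous (fun z => f' (F z)).
Proof.
move=> z; apply: (@continuous_comp _ _ _ F f'); first exact: F_continuous.
exact: cutoff'_continuous.
Qed.

Let gp_continuous : continuous gp.
Proof. by move=> z; apply: cvgZ; [exact: f'F_continuous|exact: grad_p_continuous]. Qed.

Let gq_continuous : continuous gq.
Proof. by move=> z; apply: cvgZ; [exact: f'F_continuous|exact: grad_q_continuous]. Qed.

Let g_periodic p q v : v \is a mxOver Num.int ->
  gp (p, q + v) = gp (p, q) /\ gq (p, q + v) = gq (p, q).
Proof.
by move=> v_int; have [P Q] := grad_periodic p q v_int; rewrite /gp /gq F_periodic// P Q.
Qed.

Let V := ham_field gp gq.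

Let V_continuous : continuous V.
Proof.
apply: pair_continuous; last exact: gp_continuous.
by move=> z; apply: cvgN; exact: gq_continuous.
Qed.

Let V_periodic p q v : v \is a mxOver Num.int -> V (p, q + v) = V (p, q).
Proof. by move=> v_int; have [P Q] := g_periodic p q v_int; rewrite /V /ham_field P Q. Qed.

Let V_supp z : R0 < `|z.1| -> V z = 0.
Proof.
move=> /F_supp Fz.
have f'0 : f' (F z) = 0.
  by rewrite Fz; apply/eqP/negPn/negP => /(cutoff'_neq0 ab); rewrite ltNge (ltW a_gt0).
have -> : V z = (- gq z, gp z) by [].
by rewrite /gp /gq f'0 !scale0r oppr0.
Qed.

Let K_continuous : continuous K.
Proof.
move=> z; apply: (@continuous_comp _ _ _ F f); first exact: F_continuous.
apply/differentiable_continuous/derivable1_diffP.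
by have [] := is_derive_cutoff a b (s + 2) (F z).
Qed.

Let K_derive (z h : phase) (t : R) :
  is_derive t 1 (fun t : R => K (z + t *: h))
    (dot (gp (z + t *: h)) h.1 + dot (gq (z + t *: h)) h.2).
Proof.
have line : is_derive t 1 (fun t : R => z + t *: h) h.
  apply: is_derive_first_order => e e0; exists 1 => // k _.
  rewrite (_ : _ - _ = 0) ?normr0 ?mulr_ge0 ?(ltW e0)//.
  by rewrite scalerDl addrA [X in X - _ - _]addrC addrK subrr.
have dF := is_derive_comp_curve (F_diff _) line.
have dK := @is_derive1_comp R f (F \o (fun t : R => z + t *: h)) t _ _
  (is_derive_cutoff a b (s + 2) _) dF.
apply: (is_derive_eq dK).
by rewrite differential_grad mulrDr -!dotZl.
Qed.

(** By the mean value theorem the remainder is the scalar product of [h] with the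
variation of the gradient along a segment, and the gradient is uniformly
continuous. *)
Let K_unif_diff (e : R) : 0 < e -> exists2 d : R, 0 < d &
  forall z h : phase, `|h| <= d -> `|remainder K gp gq z h| <= e * `|h|.
Proof.
move=> e0; have n0 : 0 < 2 * n%:R + 1 :> R by rewrite ltr_wpDl// mulr_ge0.
have e1 : 0 < e / (2 * n%:R + 1) by rewrite divr_gt0.
have [d d0 Hd] := periodic_unif_continuous V_continuous V_periodic R0_ge0 V_supp e1.
exists d => // z h hd.
have [|c c01] := @MVT R (fun t : R => K (z + t *: h)) _ 0 1 ltr01 (fun t _ => K_derive z h t).
  apply: continuous_subspaceT => t; apply/differentiable_continuous/derivable1_diffP.
  by have [] := K_derive z h t.
rewrite subr0 mulr1 scale1r scale0r addr0 => KE.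
move: c01; rewrite in_itv /= => /andP[c0 c1].
have := Hd (z + c *: h) z; rewrite [X in `|X| <= d](_ : _ = c *: h); last by rewrite addrC addKr.
have ch : `|c *: h| <= d by rewrite normrZ gtr0_norm// (le_trans _ hd)// ler_piMl// ltW.
move=> /(_ ch) VV.
have : `|- (gq (z + c *: h) - gq z)| <= e / (2 * n%:R + 1) /\
    `|gp (z + c *: h) - gp z| <= e / (2 * n%:R + 1).
  apply/andP; move: VV; rewrite (pair_norm_le (V (z + c *: h) - V z)) /V /ham_field /=.
  by rewrite opprB addrC opprK.
rewrite normrN => -[Vq Vp].
have -> : remainder K gp gq z h =
    dot (gp (z + c *: h) - gp z) h.1 + dot (gq (z + c *: h) - gq z) h.2.
  by rewrite /remainder KE opprD addrACA -!dotBl.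
have [h1 h2] : `|h.1| <= `|h| /\ `|h.2| <= `|h| by apply/andP; rewrite -pair_norm_le.
apply: le_trans (ler_normD _ _) _.
have dle (x y : 'cV[R]_n) : `|x| <= e / (2 * n%:R + 1) -> `|y| <= `|h| ->
    `|dot x y| <= n%:R * (e / (2 * n%:R + 1) * `|h|).
  by move=> xe yh; apply: le_trans (dot_le _ _) _; rewrite ler_wpM2l// ler_pM.
have H1 := dle _ _ Vp h1; have H2 := dle _ _ Vq h2.
apply: (le_trans (lerD H1 H2)).
have -> : e * `|h| = (2 * n%:R + 1) * (e / (2 * n%:R + 1) * `|h|).
  by field; rewrite gt_eqF.
by apply: twice_mul_le; rewrite mulr_ge0// ltW.
Qed.

Let K_barrier p q : dot p alpha = 0 -> K (p, q) = 0.
Proof.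
move=> pa; rewrite /K (_ : F (p, q) = 0); first by rewrite /f cutoff_eq0// ltW.
by apply/eqP/negPn/negP => /F_cone /=; rewrite pa ltxx.
Qed.

Let K_high : exists2 rho : R, 0 < rho & forall p q, `|p - pstar| <= rho -> s + 2 <= K (p, q).
Proof.
have mb : 0 < m - b by rewrite subr_gt0.
have [d d0 Hd] := periodic_unif_continuous F_continuous F_periodic R0_ge0 F_supp mb.
exists d => // p q pd; rewrite /K /f cutoff_eq_top//.
have := Hd (p, q) (pstar, q).
rewrite (pair_norm_le ((p, q) - (pstar, q) : phase)) /= subrr normr0 pd (ltW d0) => /(_ isT).
by rewrite ler_norml => /andP[+ _]; have := F_pstar q; lra.
Qed.

Let alpha_neq0 : alpha != 0.
Proof. by apply: contraTneq s_gt0 => a0; rewrite /s a0 dotC dot0l ltxx. Qed.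

Let K_orbit : exists2 x : R -> phase, forall t, x (t + 1) = x t + (0, alpha) &
  forall e : R, 0 < e -> exists2 d : R, 0 < d &
    forall t h, `|h| <= d -> `|x (t + h) - x t - h *: V (x t)| <= e * `|h|.
Proof.
have [M HM] := periodic_bounded V_continuous V_periodic R0_ge0 V_supp.
have [rho rho0 Hrho] := K_high.
apply: (periodic_orbit alpha_int alpha_neq0 g_periodic HM _ R0_ge0 V_supp _).
  by move=> e e0; exact: (periodic_unif_continuous V_continuous V_periodic R0_ge0 V_supp e0).
move=> N delta d0.
apply: (near_critical_loop N s_gt0 rho0 _ K_barrier Hrho K_unif_diff K_continuous
  gp_continuous gq_continuous d0) => z.
exact: cutoff_ge0.
Qed.

(** The periodic orbit [x] of [K] conserves [F] because its velocity is the rotated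
gradient of [F] times [f' (F (x t))]. If that factor were zero, [x] would be at rest,
whereas its position advances by [alpha] in unit time. So the level lies strictly
between [a] and [b], and dividing the time by the factor turns [x] into an orbit
of [F]. *)
Theorem orbit_between : exists (x : R -> phase) (T h : R),
  [/\ 0 < T, a < h < b, forall t, F (x t) = h, forall t, x (t + T) = x t + (0, alpha) &
    forall t : R, is_derive t 1 (fun t : R => (x t).1) (- grad_q F (x t)) /\
              is_derive t 1 (fun t : R => (x t).2) (grad_p F (x t))].
Proof.
have [x xper xd] := K_orbit.
have dx (t : R) : is_derive t 1 x (V (x t)).
  apply: is_derive_first_order => e e0; have [d d0 Hd] := xd e e0.
  by exists d => // h hd; exact: Hd.
have dx1 (t : R) : is_derive t 1 (fun t : R => (x t).1) (- gq (x t)).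
  apply: is_derive_first_order => e e0; have [d d0 Hd] := xd e e0.
  exists d => // h hd; apply: le_trans (Hd t h hd).
  exact: (pair_norm_ge (x (t + h) - x t - h *: V (x t))).1.
have dx2 (t : R) : is_derive t 1 (fun t : R => (x t).2) (gp (x t)).
  apply: is_derive_first_order => e e0; have [d d0 Hd] := xd e e0.
  exists d => // h hd; apply: le_trans (Hd t h hd).
  exact: (pair_norm_ge (x (t + h) - x t - h *: V (x t))).2.
have energy t : F (x t) = F (x 0).
  apply: (is_derive_0_is_cst (f := F \o x)) => u.
  apply: (is_derive_eq (is_derive_comp_curve (F_diff _) (dx u))).
  have -> : V (x u) = (- gq (x u), gp (x u)) by [].
  by rewrite differential_grad; exact: dot_skew.
set h := F (x 0) in energy.
have Tpos : 0 < f' h.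
  rewrite lt_neqAle cutoff'_ge0// andbT eq_sym; apply: contra alpha_neq0 => /eqP f'h.
  have gp0 t : gp (x t) = 0 by rewrite /gp energy f'h scale0r.
  apply/eqP/colP => i; have := @is_derive_0_is_cst R (fun t : R => (x t).2 i 0) 0 1.
  have -> : x 1 = x 0 + (0, alpha) by rewrite -xper add0r.
  rewrite !mxE => H; apply/eqP; rewrite -(inj_eq (addrI ((x 0).2 i 0))) addr0.
  rewrite [eqbRHS]H ?[in eqbRHS]mxE// => t.
  apply: is_derive_first_order => e e0; have [d d0 Hd] := xd e e0.
  exists d => // k kd; apply: le_trans (Hd t k kd).
  apply: le_trans (pair_norm_ge (x (t + k) - x t - k *: V (x t))).2.
  apply: le_trans (mx_entry_le_norm _ i 0).
  by rewrite /V /ham_field /= gp0 !mxE scaler0 mulr0.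
exists (fun t => x (t * (f' h)^-1)), (f' h), h; split=> //.
- by apply: (@cutoff'_neq0 R a b (s + 2) ab h); rewrite gt_eqF.
- by move=> t; rewrite mulrDl mulfV ?gt_eqF// xper.
move=> t; split.
  apply: (is_derive_eq (is_derive_rescale (dx1 (t * (f' h)^-1)))).
  by rewrite scalerN /gq energy scalerA mulVf ?gt_eqF// scale1r.
apply: (is_derive_eq (is_derive_rescale (dx2 (t * (f' h)^-1)))).
by rewrite /gp energy scalerA mulVf ?gt_eqF// scale1r.
Qed.

End OrbitBetween.

(** * Closed orbits on the torus *)

(** If two values were different, the intermediate value theorem would produce the
value halfway between the smaller one and the next integer. *)
Lemma continuous_int_valued_const (R : realType) (f : R -> R) (s t : R) :
  continuous f -> (forall u, f u \is a Num.int) -> f s = f t.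
Proof.
move=> fc f_int; wlog st : s t / s <= t.
  by move=> H; case: (leP s t) => [/H//|/ltW/H].
apply/eqP/negPn/negP => fst.
have [v v_int vst] : exists2 v : R, ~~ (v \is a Num.int) &
    Num.min (f s) (f t) <= v <= Num.max (f s) (f t).
  exists (Num.min (f s) (f t) + 2^-1).
    apply/negP => vi; have /intrP[k kE] : 2^-1 \is a @Num.int R.
      have mi : Num.min (f s) (f t) \is a Num.int by case: (leP (f s) (f t)).
      by have := rpredB vi mi; rewrite addrAC subrr add0r.
    have k2 : 2 * k%:~R = 1 :> R by rewrite -kE mulfV// pnatr_eq0.
    have : (2 * k)%:~R = 1%:~R :> R by rewrite intrM k2.
    by move=> /intr_inj; lia.
  rewrite lerDl invr_ge0 ler0n /=.
  have [i fsi] := intrP (f_int s); have [j ftj] := intrP (f_int t).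
  rewrite fsi ftj -?(inj_eq (@intr_inj R)) in fst *.
  have ij : i != j by apply: contra fst => /eqP ->.
  have [ij'|ij'] := leP (i%:~R : R) j%:~R.
    have : i + 1 <= j by move: ij'; rewrite ler_int => ?; lia.
    by rewrite -(ler_int R) intrD; lra.
  have : j + 1 <= i by move: ij'; rewrite ltr_int => ?; lia.
  by rewrite -(ler_int R) intrD; lra.
have [c _ fcv] := IVT st (continuous_subspaceT fc) vst.
by rewrite -fcv f_int in v_int.
Qed.

(** The generators of the two cones are dual bases. *)
Lemma open_cone_dual_dot_gt0 (R : realType) (n : nat) (A : 'M[R]_n) (u alpha : 'cV[R]_n) :
  (0 < n)%N -> A \in unitmx -> open_cone (fun i => col i A) u ->
  open_cone (fun i => invmx A^T *m delta_mx i 0) alpha -> 0 < dot u alpha.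
Proof.
move=> n0 uA [c [c0 ->]] [b [b0 ->]].
have dual i j : dot (col i A) (invmx A^T *m delta_mx j 0) = (i == j)%:R.
  have dotE (x y : 'cV[R]_n) : dot x y = (x^T *m y) 0 0.
    by rewrite mxE; apply: eq_bigr => k _; rewrite mxE.
  rewrite dotE tr_col mulmxA -row_mul mulmxV ?unitmx_tr//.
  by rewrite -colE !mxE.
rewrite dot_suml (eq_bigr (fun i => c i * b i)) => [|i _].
  rewrite (bigD1 (Ordinal n0))//= ltr_pwDl ?mulr_gt0//.
  by apply: sumr_ge0 => i _; rewrite mulr_ge0// ltW.
rewrite dot_sumr (bigD1 i)//= big1 ?addr0 => [|j ji].
  by rewrite dotZl dotZr dual eqxx mulr1.
by rewrite dotZl dotZr dual eq_sym (negPf ji) !mulr0.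
Qed.

Section ClosedOrbit.
Variables (R : realType) (n : nat) (H : cotangent R n -> R) (alpha : 'cV[R]_n).
Hypothesis alpha_int : alpha \is a mxOver Num.int.

Lemma lift_fun_periodic p q v : v \is a mxOver Num.int ->
  lift_fun H (p, q + v) = lift_fun H (p, q).
Proof.
move=> v_int; rewrite /lift_fun /=; congr (H (_, _)).
by apply/torus_projP; rewrite addrC addKr.
Qed.

(** Two lifts of the same curve in the torus differ by a continuous function with
integral values, hence by a constant, so all of them are displaced by [alpha] after
one period. *)
Lemma closed_orbit_of_lift (x : R -> 'cV[R]_n * 'cV[R]_n) (T : R) : 0 < T ->
  (forall t, x (t + T) = x t + (0, alpha)) ->
  (forall t : R, is_derive t 1 (fun t : R => (x t).1) (- grad_q (lift_fun H) (x t)) /\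
             is_derive t 1 (fun t : R => (x t).2) (grad_p (lift_fun H) (x t))) ->
  closed_orbit H alpha (fun t => ((x t).1, torus_proj (x t).2) : cotangent R n).
Proof.
move=> T0 xT dx.
have xc : continuous (fun t : R => (x t).2).
  move=> t; apply/differentiable_continuous/derivable1_diffP.
  by have [_ []] := dx t.
split.
  exists (fun t => (x t).2); first by split.
  by move=> t /=; rewrite -surjective_pairing; have [] := dx t.
exists T; split=> // [t|qt [qtc qtE]].
  rewrite xT /= addr0; congr (_, _); apply/torus_projP.
  by rewrite addrC addKr.
have diff_int t : qt t - (x t).2 \is a mxOver Num.int by apply/torus_projP; exact: qtE.
have diff_cst i : (qt 0 - (x 0).2) i 0 = (qt T - (x T).2) i 0.
  apply: (@continuous_int_valued_const R (fun t => (qt t - (x t).2) i 0)).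
    move=> t; apply: (@continuous_comp _ _ _ (fun t : R => qt t - (x t).2) (fun M : 'cV[R]_n => M i 0)).
      by apply: cvgB; [exact: qtc|exact: xc].
    exact: coord_continuous.
  by move=> t; exact: (mxOverP (diff_int t)).
have xTE : (x T).2 = (x 0).2 + alpha by rewrite -[in LHS](add0r T) xT.
apply/colP => i; have := diff_cst i; rewrite xTE !mxE; lra.
Qed.

End ClosedOrbit.

Theorem theorem4 (R : realType) (n : nat) (hn : (0 < n)%N)
  (A : 'M[R]_n) (hA : A \in unitmx)
  (C : set 'cV[R]_n) (hC : C = open_cone (fun i => col i A))
  (Cstar : set 'cV[R]_n)
  (hCstar : Cstar = open_cone (fun i => invmx A^T *m delta_mx i 0))
  (H : cotangent R n -> R) (Hsmooth : smooth_cotangent H)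
  (Hcompact : compact (tsupport H)) (Hsupp : tsupport H `<=` C `*` [set: torus R n])
  (pstar : 'cV[R]_n) (hpstar : C pstar) (Hpos : forall q, 0 < H (pstar, q))
  (alpha : 'cV[R]_n) (alpha_int : alpha \is a mxOver Num.int)
  (alpha_neq0 : alpha != 0) (alpha_Cstar : Cstar alpha) :
  let I : set R := `]0, torus_min (fun q => H (pstar, q))[%classic in
  exists S : set R,
    [/\ S `<=` I,
        I `<=` closure S &
        forall s, S s ->
          exists2 x : R -> cotangent R n,
            closed_orbit H alpha x & forall t, H (x t) = s].
Proof.
move=> I.
have Fc : continuous (lift_fun H) by exact: Hsmooth 0%N.
have [Fd dFc] := Hsmooth 1%N.
have supp_mem z : lift_fun H z != 0 -> tsupport H (z.1, torus_proj z.2).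
  by move=> Hz; apply: subset_closure.
have F_cone z : lift_fun H z != 0 -> 0 < dot z.1 alpha.
  move=> /supp_mem /Hsupp[/= zC _]; rewrite hC in zC; rewrite hCstar in alpha_Cstar.
  exact: open_cone_dual_dot_gt0 hn hA zC alpha_Cstar.
have [R0 R00 F_supp] : exists2 R0 : R, 0 <= R0 & forall z, R0 < `|z.1| -> lift_fun H z = 0.
  have cfst : compact (fst @` tsupport H).
    by apply: continuous_compact Hcompact; apply: continuous_subspaceT => z; exact: cvg_fst.
  have [M0 [_ HM]] := compact_bounded cfst.
  exists (`|M0| + 1); first by rewrite addr_ge0.
  move=> z zR; apply/eqP/negPn/negP => /supp_mem Hz; move: zR; rewrite ltNge.
  have M01 : M0 < `|M0| + 1 by apply: le_lt_trans (ler_norm _) _; rewrite ltrDl.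
  have -> // : `|z.1| <= `|M0| + 1.
  by apply: (HM _ M01); exists (z.1, torus_proj z.2).
have Hc : continuous (fun q => H (pstar, q)).
  apply/quotient_continuous => v.
  apply: (@continuous_comp _ _ _ (fun v : 'cV[R]_n => (pstar, v)) (lift_fun H)).
    exact: (pair_continuous (fun=> cvg_cst _) (fun=> cvg_id)).
  exact: Fc.
have [_ m_le] := torus_minP Hc; set m := torus_min _ in m_le *.
exists [set s | I s /\ exists2 x : R -> cotangent R n,
  closed_orbit H alpha x & forall t, H (x t) = s]; split=> [s []//|s Is B|s []//].
move=> /nbhs_ballP[e /= e0 eB].
move: Is; rewrite /I /= in_itv /= => /andP[s0 sm].
(* half of the minimum, so that s - d and s + d stay strictly inside all the bounds *)
pose d := Num.min e (Num.min s (m - s)) / 2.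
have d0 : 0 < d by rewrite divr_gt0// !lt_min e0 s0 subr_gt0.
have [de ds dm] : [/\ d < e, d < s & d < m - s].
  have := d0; rewrite /d pmulr_lgt0 ?invr_gt0// => mn0.
  have : Num.min e (Num.min s (m - s)) / 2 < Num.min e (Num.min s (m - s)) by lra.
  by rewrite !lt_min => /andP[? /andP[]].
have [||||x [T [h [T0 /andP[ah hb] Fx xT dx]]]] := @orbit_between R n (lift_fun H)
  alpha pstar R0 (s - d) (s + d) m Fc Fd dFc (@lift_fun_periodic R n H) R00 F_supp alpha_int F_cone _ _ _ _.
- by rewrite subr_gt0.
- by lra.
- by lra.
- by move=> q; exact: m_le.
exists h; split; last by apply: eB; rewrite /ball /= ltr_norml; lra.
split; first by rewrite /I /= in_itv /=; lra.
exists (fun t => ((x t).1, torus_proj (x t).2)); last exact: Fx.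
exact: closed_orbit_of_lift T0 xT dx.
Qed.
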